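(* Let $\tau_L,\delta_L,\tau_R,\delta_R\in\mathbb{R}$ and $\mu\neq 0$, and let $f$ be the two-dimensional border-collision normal form with these parameters. Let $\mathcal{X}$ and $\mathcal{Y}$ be words in the symbols $L,R$, with $\mathcal{X}$ primitive and $\mathcal{X}_0\neq\mathcal{Y}_0$, and let $\mathcal{S}[k]=\mathcal{X}^k\mathcal{Y}$. Suppose there exist infinitely many values of $k\ge 1$ for which $f$ exhibits a unique, admissible, stable $\mathcal{S}[k]$-cycle that has no points on the switching manifold $x=0$. Suppose $\lambda_1$ and $\lambda_2$ are the eigenvalues of $M_{\mathcal{X}}$, where $0\le\lambda_1<1<\lambda_2$, and that the $v$-axis is not parallel to the switching manifold. Suppose in addition that $f$ is invertible and that $\Xi$ intersects the switching manifold at only two points. Then $\Phi_{n_{\mathcal{X}}+n_{\mathcal{Y}}}$ is the line segment connecting $c$ and $d$, and the branches of the stable and unstable manifolds of the $\mathcal{X}$-cycle that involve the homoclinic orbit to which the $\mathcal{S}[k]$-cycles limit as $k\to\infty$ are coincident.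
   Context: The two-dimensional border-collision normal form is the continuous map $f:\mathbb{R}^2\to\mathbb{R}^2$, $f(x,y)=f^L(x,y)$ if $x\le 0$ and $f(x,y)=f^R(x,y)$ if $x\ge 0$, where for $J\in\{L,R\}$ $$f^J(x,y)=A_J\begin{bmatrix} x \\ y \end{bmatrix}+\begin{bmatrix} 1 \\ 0 \end{bmatrix}\mu,\qquad A_J=\begin{bmatrix} \tau_J & 1 \\ -\delta_J & 0 \end{bmatrix}.$$ The line $x=0$ is the switching manifold. The map $f$ is invertible if and only if $\delta_L\delta_R>0$. Words and symbol sequences. A word $\mathcal{W}=\mathcal{W}_0\cdots\mathcal{W}_{n-1}$ in $\{L,R\}$ is primitive if it is not a power $\mathcal{V}^m$, $m\ge2$, of a shorter word. A word is identified with the periodic symbol sequence obtained by repeating it infinitely. $n_{\mathcal{W}}$ denotes the length of $\mathcal{W}$. $\mathcal{X}^k\mathcal{Y}$ denotes $k$ copies of $\mathcal{X}$ followed by $\mathcal{Y}$. For a word $\mathcal{S}$ of length $n$, $f^{\mathcal{S}}=f^{\mathcal{S}_{n-1}}\circ\cdots\circ f^{\mathcal{S}_0}$, an affine map with matrix part $M_{\mathcal{S}}=A_{\mathcal{S}_{n-1}}\cdots A_{\mathcal{S}_0}$. Cycles. An $\mathcal{S}$-cycle is a tuple of points $(x_i,y_i)$, $i$ modulo $n$, with $(x_{i+1},y_{i+1})=f^{\mathcal{S}_i}(x_i,y_i)$ for all $i$; it is determined by $(x_0,y_0)$, which is a fixed point of $f^{\mathcal{S}}$. It is unique if and only if $\det(I-M_{\mathcal{S}})\ne0$;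 then its points are denoted $w_i^{\mathcal{S}}=(x_i^{\mathcal{S}},y_i^{\mathcal{S}})$. It is admissible if $x_i\le0$ whenever $\mathcal{S}_i=L$ and $x_i\ge0$ whenever $\mathcal{S}_i=R$; in that case it is a periodic solution of $f$. Stable means (Lyapunov) stable as a periodic solution of $f$ (not necessarily asymptotically stable). $(u,v)$-coordinates. Let $\zeta_1,\zeta_2$ be eigenvectors of $M_{\mathcal{X}}$ for $\lambda_1,\lambda_2$, let $Q=[\zeta_1\;\zeta_2]$, and set $$\begin{bmatrix} u \\ v \end{bmatrix}=Q^{-1}\left(\begin{bmatrix} x \\ y \end{bmatrix}-\begin{bmatrix} x_0^{\mathcal{X}} \\ y_0^{\mathcal{X}} \end{bmatrix}\right).$$ The $u$-axis is the line $v=0$, the $v$-axis is the line $u=0$, and the origin of these coordinates is $w_0^{\mathcal{X}}$. Points of the plane are written in either coordinate system interchangeably. The homoclinic orbit. Under the hypotheses of the first paragraph of the claim, the $\mathcal{X}$-cycle is admissible, $\lambda_2=1/\lambda_1$, and the $\mathcal{S}[k]$-cycles limit as $k\to\infty$ to an orbit of $f$ homoclinic to the $\mathcal{X}$-cycle, in the sense that for each fixed $i\in\mathbb{Z}$ the point of the $\mathcal{S}[k]$-cycle with index $kn_{\mathcal{X}}+i$ (modulo $kn_{\mathcal{X}}+n_{\mathcal{Y}}$) converges to the $i$-th point of that orbit. Four points of this orbit are $$a=\lim_{k\to\infty}w^{\mathcal{S}[k]}_{(k-1)n_{\mathcal{X}}},\quad b=\lim_{k\to\infty}w^{\mathcal{S}[k]}_{kn_{\mathcal{X}}},\quad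 c=\lim_{k\to\infty}w^{\mathcal{S}[k]}_0,\quad d=\lim_{k\to\infty}w^{\mathcal{S}[k]}_{n_{\mathcal{X}}}.$$ In $(u,v)$-coordinates $a,b$ lie on the $v$-axis with $a=\lambda_1 b$, and $c,d$ lie on the $u$-axis with $d=\lambda_1c$ ($b,c\neq0$). Under $f$, $a$ maps to $b$ following $\mathcal{X}$, $b$ maps to $c$ following $\mathcal{Y}$, and $c$ maps to $d$ following $\mathcal{X}$. $\Phi_0$ is the closed line segment connecting $a$ and $b$; $\Phi_i=f(\Phi_{i-1})$ for $i=1,\ldots,n_{\mathcal{X}}+n_{\mathcal{Y}}$; and $\Xi=\bigcup_{i=0}^{n_{\mathcal{X}}+n_{\mathcal{Y}}-1}\Phi_i$. Branches. Locally near the origin the stable and unstable manifolds of $w_0^{\mathcal{X}}$ coincide with the $u$-axis and $v$-axis in the directions of $c$ and $b$ respectively. The branch of the unstable manifold of the $\mathcal{X}$-cycle involving the homoclinic orbit is $\bigcup_{i\in\mathbb{Z}}f^i(\{tb:0<t\le1\})$, and the branch of the stable manifold involving it is $\bigcup_{i\in\mathbb{Z}}f^i(\{tc:0<t\le1\})$, where $tb,tc$ are taken in $(u,v)$-coordinates and $f^i$ denotes the $i$-th iterate of $f$. Coincident means that these two sets are equal. *)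

(* Defs.v *)
From HB Require Import structures.
From mathcomp Require Import all_boot all_order all_algebra.
From mathcomp Require Import all_classical all_reals all_analysis.

Set Implicit Arguments.
Unset Strict Implicit.
Unset Printing Implicit Defensive.

Import Order.TTheory GRing.Theory Num.Theory.
Import numFieldNormedType.Exports.

Local Open Scope classical_set_scope.
Local Open Scope ring_scope.

(** * Words in the symbols L and R *)

Variant symbol := SymL | SymR.

Definition word := seq symbol.

Definition word_pow (W : word) (k : nat) : word := flatten (nseq k W).

Definition primitive (W : word) : Prop :=
  W <> [::] /\
  ~ exists (V : word) (m : nat),
      [/\ (2 <= m)%N, (size V < size W)%N & W = word_pow V m].

(* The periodic symbol sequence obtained by repeating [W]; the default value
   of [nth] is only reached for the empty word. *)
Definition symb (W : word) (i : nat) : symbol := nth SymL W (i %% size W).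

Definition XkY (X Y : word) (k : nat) : word := word_pow X k ++ Y.

(** * The border-collision normal form *)

Record bcnf (R : realType) := BCNF {
  tauL : R; deltaL : R; tauR : R; deltaR : R; mu : R }.

Section BorderCollision.
Context {R : realType}.
Implicit Types (p : bcnf R) (z : 'cV[R]_2) (J : symbol) (S X Y : word).

Definition xcoord z : R := z ord0 ord0.

Definition switching_manifold : set 'cV[R]_2 := [set z | xcoord z = 0].

Definition companion (tau delta : R) : 'M[R]_2 :=
  \matrix_(i < 2, j < 2)
    if i == 0 then (if j == 0 then tau else 1)
    else (if j == 0 then - delta else 0).

Definition mat p J : 'M[R]_2 :=
  match J with
  | SymL => companion (tauL p) (deltaL p)
  | SymR => companion (tauR p) (deltaR p)
  end.

Definition piece p J z : 'cV[R]_2 := mat p J *m z + mu p *: delta_mx ord0 ord0.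

(* The two pieces agree where [xcoord z = 0]. *)
Definition bcmap p z : 'cV[R]_2 :=
  if xcoord z <= 0 then piece p SymL z else piece p SymR z.

(* M_S = A_{S_{n-1}} ... A_{S_0}: the first symbol acts first. *)
Definition word_mx p S : 'M[R]_2 := foldl (fun M J => mat p J *m M) 1%:M S.

(** * Cycles *)

(* Points indexed modulo the length of [S] are encoded as a periodic function
   on [nat]. *)
Definition is_cycle p S (w : nat -> 'cV[R]_2) : Prop :=
  forall i, w i.+1 = piece p (symb S i) (w i) /\ w (i + size S)%N = w i.

Definition admissible S (w : nat -> 'cV[R]_2) : Prop :=
  forall i, match symb S i with
            | SymL => xcoord (w i) <= 0
            | SymR => 0 <= xcoord (w i)
            end.

(* [`| |] is the sup norm on R^2. *)
Definition lyapunov_stable (f : 'cV[R]_2 -> 'cV[R]_2) (z0 : 'cV[R]_2) : Prop :=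
  forall eps : R, 0 < eps ->
    exists2 delta : R, 0 < delta &
      forall z, `|z - z0| < delta ->
        forall m, `|iter m f z - iter m f z0| < eps.

Definition has_good_cycle p S : Prop :=
  exists w, [/\ unique (is_cycle p S) w,
                admissible S w,
                lyapunov_stable (bcmap p) (w 0%N) &
                forall i, ~ switching_manifold (w i)].

(* w_i^S; meaningful only when there is exactly one S-cycle ([get] returns an
   arbitrary S-cycle if there are several, a default value if there is none). *)
Definition cycle_pt p S : nat -> 'cV[R]_2 := get (is_cycle p S).

(** * (u,v)-coordinates *)

Definition eigenvector (M : 'M[R]_2) (lambda : R) (zeta : 'cV[R]_2) : Prop :=
  zeta <> 0 /\ M *m zeta = lambda *: zeta.

(* The coordinates (u, v) of the point [z], as a column vector. *)
Definition uv p X (zeta1 zeta2 z : 'cV[R]_2) : 'cV[R]_2 :=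
  invmx (row_mx zeta1 zeta2 : 'M[R]_2) *m (z - cycle_pt p X 0%N).

(* A line with direction [dir] is parallel to x = 0. *)
Definition parallel_to_switching (dir : 'cV[R]_2) : Prop := xcoord dir = 0.

(** * The homoclinic orbit *)

(* Finitely many [k] for which the X^k Y-cycle is not unique do not affect
   these limits. *)
Definition hom_a p X Y : 'cV[R]_2 :=
  lim ((fun k => cycle_pt p (XkY X Y k) (k.-1 * size X)%N) @ \oo).
Definition hom_b p X Y : 'cV[R]_2 :=
  lim ((fun k => cycle_pt p (XkY X Y k) (k * size X)%N) @ \oo).
Definition hom_c p X Y : 'cV[R]_2 :=
  lim ((fun k => cycle_pt p (XkY X Y k) 0%N) @ \oo).
Definition hom_d p X Y : 'cV[R]_2 :=
  lim ((fun k => cycle_pt p (XkY X Y k) (size X)) @ \oo).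

Definition segment (z1 z2 : 'cV[R]_2) : set 'cV[R]_2 :=
  [set z | exists2 t : R, 0 <= t <= 1 & z = (1 - t) *: z1 + t *: z2].

Fixpoint Phi p X Y (i : nat) : set 'cV[R]_2 :=
  match i with
  | 0%N => segment (hom_a p X Y) (hom_b p X Y)
  | j.+1 => bcmap p @` Phi p X Y j
  end.

Definition Xi p X Y : set 'cV[R]_2 :=
  \bigcup_(i in [set i | (i < size X + size Y)%N]) Phi p X Y i.

(** * Branches of the invariant manifolds *)

(* f^i(A) for an integer [i] and invertible [f]; for negative [i] the image
   under the inverse is the preimage. *)
Definition iter_image (f : 'cV[R]_2 -> 'cV[R]_2) (i : int) (A : set 'cV[R]_2)
    : set 'cV[R]_2 :=
  match i with
  | Posz n => iter n f @` A
  | Negz n => iter n.+1 f @^-1` A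
  end.

(* { t q : 0 < t <= 1 }, with t q computed in (u,v)-coordinates. *)
Definition local_branch p X (zeta1 zeta2 q : 'cV[R]_2) : set 'cV[R]_2 :=
  [set z | exists2 t : R, 0 < t <= 1 &
     uv p X zeta1 zeta2 z = t *: uv p X zeta1 zeta2 q].

Definition branch p X (zeta1 zeta2 q : 'cV[R]_2) : set 'cV[R]_2 :=
  \bigcup_(i in [set: int])
    iter_image (bcmap p) i (local_branch p X zeta1 zeta2 q).

Definition unstable_branch p X Y (zeta1 zeta2 : 'cV[R]_2) : set 'cV[R]_2 :=
  branch p X zeta1 zeta2 (hom_b p X Y).

Definition stable_branch p X Y (zeta1 zeta2 : 'cV[R]_2) : set 'cV[R]_2 :=
  branch p X zeta1 zeta2 (hom_c p X Y).

End BorderCollision.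

(* Main.v *)
Require Import Defs.
From HB Require Import structures.
From mathcomp Require Import all_boot all_order all_algebra.
From mathcomp Require Import all_classical all_reals all_analysis.
From mathcomp Require Import zify ring lra.

(** Reduction to a homoclinic orbit. Write [(u, v)] for the coordinates at the saddle point
    [w0] of the [X]-cycle. The map of [X] is [(lambda1 * u, lambda2 * v)] and the
    map of [Y] is affine, so the base point of the cycle of [X^k Y] is explicit.
    A stable cycle that avoids the switching manifold has a matrix with bounded
    powers, hence trace at most [2] and determinant at most [1] in absolute value.
    For infinitely many [k] this forces the map of [Y] to send the [v]-axis to a
    line parallel to the [u]-axis. As [X] and [Y] begin with different symbols,
    the points of the cycle after [k - 1] and [k] turns of [X] are on opposite
    sides of the switching manifold; since the [v]-axis is transverse to it, this
    leaves only [lambda1 * lambda2 = 1] and makes the map of [Y] send the [v]-axis into the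
    [u]-axis itself ([homoclinic_numbers]). The limits [a], [b], [c], [d] follow,
    with the itineraries of their orbits as limits of those of the cycles
    ([homoclinic_limit]).

    The image of the fundamental segment. The points [a] and [b] reach the
    [u]-axis along the words [X ++ Y] and [Y ++ X]. Between them,
    [f^(n_X + n_Y)] is affine along the segment except at parameters whose orbit
    meets the switching manifold. The unstable branch does not return to itself
    except by the powers of [f^n_X] ([no_ray_return]; this is where primitivity
    of [X] enters), so that each of the two points on the switching manifold
    accounts for one parameter only ([orbit_coincidence]). There are thus at most
    three affine pieces. The outer ones follow [X ++ Y] and [Y ++ X], both of which
    map the [v]-axis to the [u]-axis, and a middle one joins two points of the
    [u]-axis. When an end of the segment is itself responsible for one of the two
    points, at least one of the outer pieces is still good ([one_end_good]), and
    the other joins two points of the axis. So the whole image lies in the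
    [u]-axis ([image_on_axis]); being an injective curve from [c] to [d], it is
    the segment between them ([image_segment]).

    The branches. The segments from [a] to [b] and from [c] to [d] are fundamental
    domains of the two branches, and one is an iterate of the other, so the
    branches coincide. *)

Set Implicit Arguments.
Unset Strict Implicit.
Unset Printing Implicit Defensive.

Import Order.TTheory GRing.Theory Num.Theory.
Import numFieldNormedType.Exports.

Local Open Scope classical_set_scope.
Local Open Scope ring_scope.

(** * Following a word *)

Section Following.
Context {R : realType} (p : bcnf R).
Implicit Types (z h : 'cV[R]_2) (J : symbol) (S T : word).

Definition symb_sign J : R := match J with SymL => -1 | SymR => 1 end.

(** Membership of the closed half-plane of [J], as one inequality for both
    symbols: it is then linear in [z], hence closed and convex. *)
Definition side J z : Prop := 0 <= symb_sign J * xcoord z.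

Definition pieces S z : 'cV[R]_2 := foldl (fun z J => piece p J z) z S.

(** The affine pieces prescribed by [S] are those that [bcmap p] itself uses
    along the orbit of [z]; points of the switching manifold may count for
    either side. *)
Fixpoint follows S z : Prop :=
  match S with
  | [::] => True
  | J :: S' => side J z /\ follows S' (piece p J z)
  end.

(** On the switching manifold the two pieces agree, so closed sides suffice. *)
Lemma bcmap_side J z : side J z -> bcmap p z = piece p J z.
Proof.
rewrite /side /bcmap; case: J => /= zJ.
  have -> : xcoord z <= 0 by lra.
  by [].
case: ifPn => // xz.
have x0 : z ord0 ord0 = 0 by move: zJ xz; rewrite /xcoord; lra.
rewrite /piece; congr (_ + _); apply/matrixP => i j.
rewrite !mxE !big_ord_recl !big_ord0 !mxE (ord1 j) x0.
by rewrite !mulr0 !add0r; case: (i == 0).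
Qed.

Lemma side_opp J K z : J <> K -> side J z -> side K z -> xcoord z = 0.
Proof. by rewrite /side; case: J K => [] [] //= _ *; lra. Qed.

Lemma side_total J z : side J z \/ symb_sign J * xcoord z < 0.
Proof. by rewrite /side; case: lerP; [left|right]. Qed.

Lemma piece_add J z h : piece p J (z + h) = piece p J z + mat p J *m h.
Proof. by rewrite /piece mulmxDr addrAC. Qed.

Lemma word_mx_cons J S : word_mx p (J :: S) = word_mx p S *m mat p J.
Proof.
rewrite /word_mx /= mulmx1.
suff foldlE (M : 'M[R]_2) : foldl (fun N K => mat p K *m N) M S =
    foldl (fun N K => mat p K *m N) 1%:M S *m M by exact: foldlE.
elim/last_ind: S M => [|S K IH] M; first by rewrite /= mul1mx.
by rewrite -cats1 !foldl_cat /= IH mulmxA.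
Qed.

Lemma word_mx_cat S T : word_mx p (S ++ T) = word_mx p T *m word_mx p S.
Proof.
elim: S => [|J S IH]; first by rewrite {2}/word_mx /= mulmx1.
by rewrite cat_cons !word_mx_cons IH mulmxA.
Qed.

Lemma pieces_add S z h : pieces S (z + h) = pieces S z + word_mx p S *m h.
Proof.
elim: S z h => [|J S IH] z h; first by rewrite /word_mx /= mul1mx.
by rewrite /= piece_add IH word_mx_cons mulmxA.
Qed.

Lemma pieces_cat S T z : pieces (S ++ T) z = pieces T (pieces S z).
Proof. exact: foldl_cat. Qed.

Lemma pieces_comb S t z1 z2 :
  pieces S ((1 - t) *: z1 + t *: z2) =
  (1 - t) *: pieces S z1 + t *: pieces S z2.
Proof.
have -> : (1 - t) *: z1 + t *: z2 = z1 + t *: (z2 - z1).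
  by rewrite scalerBl scale1r scalerBr addrA addrAC.
have -> : pieces S z2 = pieces S z1 + word_mx p S *m (z2 - z1).
  by rewrite -pieces_add addrC subrK.
rewrite pieces_add -scalemxAr scalerDr scalerBl scale1r.
by rewrite addrA subrK.
Qed.

Lemma side_comb J t z1 z2 : 0 <= t <= 1 ->
  side J z1 -> side J z2 -> side J ((1 - t) *: z1 + t *: z2).
Proof.
rewrite /side /xcoord !mxE => /andP[t0 t1].
by case: J => /= *; nra.
Qed.

Lemma follows_comb S t z1 z2 : 0 <= t <= 1 ->
  follows S z1 -> follows S z2 -> follows S ((1 - t) *: z1 + t *: z2).
Proof.
move=> t01; elim: S z1 z2 => //= J S IH z1 z2 [s1 f1] [s2 f2].
split; first exact: side_comb.
by have /= -> := pieces_comb [:: J] t z1 z2; apply: IH.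
Qed.

Lemma follows_cat S T z :
  follows (S ++ T) z <-> follows S z /\ follows T (pieces S z).
Proof.
elim: S z => [|J S IH] z /=; first by split=> [|[]].
by rewrite IH; split=> [[? []]|[[]]].
Qed.

Lemma follows_take k S z : follows S z -> follows (take k S) z.
Proof. by rewrite -{1}(cat_take_drop k S) => /follows_cat[]. Qed.

Lemma iter_follows S z :
  follows S z -> iter (size S) (bcmap p) z = pieces S z.
Proof.
elim: S z => //= J S IH z [sJ fS].
by rewrite -iterS iterSr (bcmap_side sJ) IH.
Qed.

Lemma iter_follows_take k S z : follows S z -> (k <= size S)%N ->
  iter k (bcmap p) z = pieces (take k S) z.
Proof.
move=> /(follows_take k) fS kS.
by rewrite -(iter_follows fS) size_takel.
Qed.

Lemma followsP S z : follows S z <->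
  forall i, (i < size S)%N -> side (nth SymL S i) (iter i (bcmap p) z).
Proof.
elim: S z => [|J S IH] z /=; first by split.
split=> [[sJ fS] [|i] iS //|H].
  by rewrite iterSr (bcmap_side sJ); apply: (IH _).1.
have sJ : side J z by apply: (H 0%N).
split=> //; apply/IH => i iS.
by rewrite -(bcmap_side sJ) -iterSr; apply: (H i.+1).
Qed.

Definition ccont (g : R -> 'cV[R]_2) : Prop :=
  forall i, continuous (fun s => g s i ord0).

(** The two pieces have the same second column, so that the map is affine in [x],
    [y] and the absolute value of [x]. *)
Lemma ccont_bcmap g : ccont g -> ccont (bcmap p \o g).
Proof.
move=> gC i.
pose x s := g s ord0 ord0; pose e (a b : R) := if i == 0 then a else b.
have xC : continuous x by exact: gC.
pose A J := mat p J i ord0.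
have E : (fun s => (bcmap p \o g) s i ord0) =
  (fun s => (A SymL + A SymR) / 2 * x s + (A SymR - A SymL) / 2 * `|x s|
            + mat p SymL i (lift ord0 ord0) * g s (lift ord0 ord0) ord0
            + mu p * (delta_mx ord0 ord0 : 'cV[R]_2) i ord0).
  apply/funext => s.
  have xsE : x s = xcoord (g s) by [].
  have mE : mat p SymR i (lift ord0 ord0) = mat p SymL i (lift ord0 ord0).
    by rewrite !mxE.
    have pE J z : piece p J z i ord0 = mat p J i ord0 * z ord0 ord0 +
      mat p J i (lift ord0 ord0) * z (lift ord0 ord0) ord0 +
      mu p * (delta_mx ord0 ord0 : 'cV[R]_2) i ord0.
    rewrite /piece [LHS]mxE [X in X + _]mxE [X in _ + X]mxE.
    by rewrite !big_ord_recl big_ord0 addr0.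
  rewrite /comp /bcmap; case: ifPn => xs; rewrite pE ?mE.
    by rewrite ler0_norm ?xsE // /A -/(x s) xsE; field.
  by rewrite gtr0_norm ?xsE ?ltNge // /A -/(x s) xsE; field.
rewrite E => s; do ![apply: cvgD]; try exact: cvg_cst.
- by apply: cvgM; [exact: cvg_cst|exact: xC].
- by apply: cvgM; [exact: cvg_cst|apply: cvg_norm; exact: xC].
- by apply: cvgM; [exact: cvg_cst|exact: gC].
Qed.

Lemma ccont_iter k g : ccont g -> ccont (fun s => iter k (bcmap p) (g s)).
Proof. by move=> gC; elim: k => //= k IH; exact: (ccont_bcmap IH). Qed.

Lemma ccont_line z h : ccont (fun s => z + s *: h).
Proof.
move=> i s; under eq_fun do rewrite !mxE.
apply: cvgD; first exact: cvg_cst.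
by apply: cvgM; [exact: cvg_id|exact: cvg_cst].
Qed.

End Following.

(** * Sign changes and periodic words *)

Lemma sign_change (R : realType) (h : R -> R) (a b : R) : continuous h ->
  h a < 0 -> 0 < h b ->
  exists2 c, h c = 0 & Num.min a b < c < Num.max a b.
Proof.
move=> hC ha hb.
have ab : a <> b by move=> ab; move: ha; rewrite ab ltNge (ltW hb).
wlog ab' : h a b hC ha hb {ab} / a < b => [W|].
  have [ab'|ba|//] := ltrgtP a b.
    have [c hc cI] := W _ _ _ hC ha hb ab'; exists c => //.
    by move: cI; rewrite (min_l (ltW ab')) (max_r (ltW ab')).
  have [|||c hc cI] := W (fun x => - h x) b a _ _ _ ba.
  - by move=> x; apply: cvgN; exact: hC.
  - by rewrite oppr_lt0.
  - by rewrite oppr_gt0.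
  exists c; first by apply/eqP; rewrite -oppr_eq0 hc.
  by move: cI; rewrite (min_l (ltW ba)) (max_r (ltW ba)).
have hC' : {within `[a, b], continuous h}%classic.
  by apply: continuous_subspaceT => x; exact: hC.
have [|c cI hc] := IVT (ltW ab') hC' (v := 0).
  by rewrite ge_min le_max (ltW ha) (ltW hb) orbT.
exists c => //; move: cI; rewrite in_itv /= => /andP[ac cb].
rewrite gt_min lt_max.
have ca : a < c.
  by rewrite lt_neqAle ac andbT; apply/eqP => e; move: ha; rewrite e hc ltxx.
have cb' : c < b.
  by rewrite lt_neqAle cb andbT; apply/eqP => e; move: hb; rewrite -e hc ltxx.
by rewrite ca cb' orbT.
Qed.

Lemma size_word_pow (W : word) e : size (word_pow W e) = (e * size W)%N.
Proof. by elim: e => //= e IH; rewrite size_cat IH. Qed.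

Lemma nth_word_pow (W : word) e k : (k < e * size W)%N ->
  nth SymL (word_pow W e) k = nth SymL W (k %% size W).
Proof.
elim: e k => [|e IH] k; first by rewrite mul0n.
rewrite mulSn => ke; rewrite /= nth_cat; case: ltnP => kW.
  by rewrite modn_small.
rewrite IH; last by rewrite ltn_subLR.
by rewrite -[in RHS](subnK kW) modnDr.
Qed.

(** Otherwise the word would be a power of its prefix of length [i]. *)
Lemma primitive_aperiodic (W : word) i : primitive W ->
  (0 < i)%N -> (i < size W)%N -> (i %| size W)%N ->
  exists2 j, (j + i < size W)%N & nth SymL W j <> nth SymL W (j + i).
Proof.
move=> [_ Wprim] i0 iW /dvdnP[e We].
have [//|/forall2NP per] := pselect
  (exists2 j, (j + i < size W)%N & nth SymL W j <> nth SymL W (j + i)).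
case: Wprim; exists (take i W), e.
have si : size (take i W) = i by rewrite size_takel // ltnW.
split; [|by rewrite si|].
  by case: e We => [|[|e]] //; rewrite ?mul0n ?mul1n => eW; lia.
have modE k : (k < size W)%N -> nth SymL W k = nth SymL W (k %% i).
  elim/ltn_ind: k => k IH kW; have [ki|ik] := ltnP k i; first by rewrite modn_small.
  rewrite -[in LHS](subnK ik).
  have [//|/contrapT <-] := per (k - i)%N; first by rewrite subnK.
  rewrite IH ?(leq_ltn_trans (leq_subr _ _) kW) //; last by lia.
  by rewrite -[in RHS](subnK ik) modnDr.
apply: (@eq_from_nth _ SymL); first by rewrite size_word_pow si -We.
move=> k kW; rewrite nth_word_pow si -?We // nth_take ?ltn_pmod //.
exact: modE.
Qed.

(** * The homoclinic connection *)

(** The configuration to which the cycles converge: [w0] is a saddle point of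
    the affine map of [X], with [w0 + bv] on its unstable axis and [w0 + cv] on
    its stable axis; the affine map of [Y] sends the former axis into the
    latter, and one point to the other. *)
Record homoclinic {R : realType} (p : bcnf R) (X Y : word)
    (w0 bv cv : 'cV[R]_2) (lam : R) : Prop := Homoclinic {
  lam_gt0 : 0 < lam;
  lam_lt1 : lam < 1;
  unstable_neq0 : bv <> 0;
  stable_neq0 : cv <> 0;
  X_unstable : forall s,
    pieces p X (w0 + s *: bv) = w0 + (lam^-1 * s) *: bv;
  X_stable : forall s, pieces p X (w0 + s *: cv) = w0 + (lam * s) *: cv;
  Y_unstable : forall s, exists k, pieces p Y (w0 + s *: bv) = w0 + k *: cv;
  Y_connects : pieces p Y (w0 + bv) = w0 + cv;
  saddle_follows : follows p X w0;
  a_follows : follows p (X ++ Y) (w0 + lam *: bv);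
  b_follows : follows p (Y ++ X) (w0 + bv);
  c_follows : follows p X (w0 + cv) }.

Section Connection.
Context {R : realType} (p : bcnf R) (X Y : word).
Context (w0 bv cv : 'cV[R]_2) (lam : R).
Context (f_inj : injective (bcmap p)) (X_prim : primitive X).
Context (Y_nonempty : Y <> [::]).
Context (H : homoclinic p X Y w0 bv cv lam).

Local Notation f := (bcmap p).
Local Notation n := (size X).
Local Notation N := (size X + size Y)%N.
Local Notation B s := (w0 + s *: bv).
Local Notation C s := (w0 + s *: cv).

Context (z1 z2 : 'cV[R]_2).
Context (two_points : forall i s, (i < N)%N -> lam <= s <= 1 ->
  xcoord (iter i f (B s)) = 0 -> iter i f (B s) = z1 \/ iter i f (B s) = z2).

Let l0 : 0 < lam := lam_gt0 H.
Let l1 : lam < 1 := lam_lt1 H.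

Lemma iter_inj k : injective (iter k f).
Proof. by elim: k => // k IH x y /= /f_inj/IH. Qed.

Lemma line_comb (q : 'cV[R]_2) s t u : s < t ->
  w0 + u *: q = (1 - (u - s) / (t - s)) *: (w0 + s *: q)
                + ((u - s) / (t - s)) *: (w0 + t *: q).
Proof.
move=> st; rewrite !scalerDr addrACA -scalerDl subrK scale1r !scalerA -scalerDl.
by congr (_ + _ *: _); field; lra.
Qed.

Lemma line_inj (q : 'cV[R]_2) s t : q <> 0 -> w0 + s *: q = w0 + t *: q -> s = t.
Proof.
move=> q0 /addrI/eqP; rewrite -subr_eq0 -scalerBl scaler_eq0 subr_eq0.
by case/orP=> /eqP.
Qed.

Lemma line0 (q : 'cV[R]_2) : w0 + 0 *: q = w0.
Proof. by rewrite scale0r addr0. Qed.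

Lemma line1 (q : 'cV[R]_2) : w0 + 1 *: q = w0 + q.
Proof. by rewrite scale1r. Qed.

Lemma comb_weight (s t u : R) : s <= u <= t -> s < t ->
  0 <= (u - s) / (t - s) <= 1.
Proof.
move=> /andP[su ut] st; rewrite divr_ge0 ?subr_ge0 //= ?(ltW st) //.
by rewrite ler_pdivrMr ?mul1r ?lerD2r // subr_gt0.
Qed.

Lemma unstable_follows (s : R) : 0 <= s <= lam -> follows p X (B s).
Proof.
move=> s01; rewrite (line_comb bv s l0); apply: follows_comb.
- exact: comb_weight.
- by rewrite line0; exact: (saddle_follows H).
- by have /follows_cat[] := a_follows H.
Qed.

Lemma stable_follows (s : R) : 0 <= s <= 1 -> follows p X (C s).
Proof.
move=> s01; rewrite (line_comb cv s ltr01); apply: follows_comb.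
- by apply: comb_weight; rewrite ?ltr01.
- by rewrite line0; exact: (saddle_follows H).
- by rewrite line1; exact: (c_follows H).
Qed.

Lemma iter_unstable k (t : R) : 0 <= t <= 1 ->
  iter (k * n) f (B (lam ^+ k * t)) = B t.
Proof.
elim: k t => [|k IH] t t01; first by rewrite expr0 mul1r.
have lk : 0 <= lam ^+ k * t <= 1.
  have := exprn_ge0 k (ltW l0).
  by have := exprn_ile1 k (ltW l0) (ltW l1); move: t01; nra.
rewrite mulSn addnC iterD iter_follows.
  rewrite (X_unstable H) exprS -(mulrA lam) mulKf ?gt_eqF //; exact: IH.
by apply: unstable_follows; rewrite exprS -mulrA; move: lk l0; nra.
Qed.

Lemma iter_stable k (t : R) : 0 <= t <= 1 ->
  iter (k * n) f (C t) = C (lam ^+ k * t).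
Proof.
elim: k t => [|k IH] t t01; first by rewrite expr0 mul1r.
rewrite mulSn addnC iterD (iter_follows (stable_follows t01)) (X_stable H).
rewrite IH ?exprSr ?mulrA //; move: t01 l0 l1; nra.
Qed.

(** ** The unstable branch does not return to itself *)

(** The return is asked for up to [lam] only: there the branch follows [X], and
    [f^r] is affine for [r] up to [n]. *)
Definition ray_return r k : Prop := 0 < k /\
  forall s, 0 <= s <= lam -> iter r f (B s) = B (k * s).

(** Conjugation by [f^n], which is a dilation of the branch, turns one return
    into two more that are closer to the saddle. There [f^r] is affine, so these
    two determine it. *)
Lemma ray_return_of r (t t' : R) : (r < n)%N -> 0 < t <= 1 -> 0 < t' <= 1 ->
  iter r f (B t) = B t' -> ray_return r (t' / t).
Proof.
move=> rn /andP[t0 t1] /andP[t'0 t'1] ret; split; first exact: divr_gt0.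
have contract (u v : R) : 0 <= u <= 1 -> 0 <= v <= 1 ->
    iter r f (B u) = B v -> iter r f (B (lam * u)) = B (lam * v).
  move=> u01 v01 uv; apply: (@iter_inj n).
  have := iter_unstable 1 v01; rewrite mul1n expr1 => ->.
  rewrite -iterD addnC iterD.
  by have := iter_unstable 1 u01; rewrite mul1n expr1 => ->.
have [P [G affine]] : exists P G : 'cV[R]_2,
    forall s : R, 0 <= s <= lam -> iter r f (B s) = P + s *: G.
  exists (pieces p (take r X) w0), (word_mx p (take r X) *m bv) => s.
  move=> /unstable_follows fs; rewrite (iter_follows_take fs) ?(ltnW rn) //.
  by rewrite pieces_add scalemxAr.
have r1 : iter r f (B (lam * t)) = B (lam * t').
  by apply: contract => //; rewrite ?t1 ?t'1 andbT ltW.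
have r2 : iter r f (B (lam * (lam * t))) = B (lam * (lam * t')).
  by apply: contract => //; move: l0 l1; nra.
rewrite affine in r1; last by move: l0 l1; nra.
rewrite affine in r2; last by move: l0 l1; nra.
have rG i : G i ord0 = t' / t * bv i ord0.
  move/matrixP/(_ i ord0): r1; move/matrixP/(_ i ord0): r2; rewrite !mxE => r2 r1.
  have lt0 : lam * (1 - lam) * t != 0.
    by rewrite !mulf_neq0 ?gt_eqF ?subr_gt0.
  apply: (mulfI lt0).
  have -> : lam * (1 - lam) * t * (t' / t * bv i ord0) =
      lam * (1 - lam) * t' * bv i ord0 by field; rewrite gt_eqF.
  lra.
have rP i : P i ord0 = w0 i ord0.
  move/matrixP/(_ i ord0): r1; rewrite !mxE rG => r1.
  suff E : lam * t * (t' / t * bv i ord0) = lam * t' * bv i ord0 by lra.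
  by field; rewrite gt_eqF.
move=> s s01; rewrite affine //; apply/matrixP => i j; rewrite (ord1 j).
by rewrite !mxE rG rP; ring.
Qed.

Lemma ray_return_iter r k j (s : R) : ray_return r k -> 0 <= s ->
  s * (1 + k) ^+ j <= lam -> iter (j * r) f (B s) = B (k ^+ j * s).
Proof.
move=> [k0 ret]; elim: j s => [|j IH] s s0; first by rewrite expr0 mul1r.
rewrite exprSr mulSn addnC iterD => sl.
have p1 : 1 <= (1 + k) ^+ j by apply: exprn_ege1; rewrite lerDl ltW.
have sp : s <= s * (1 + k) ^+ j by rewrite ler_peMr.
have spk : 0 <= s * (1 + k) ^+ j * k by rewrite !mulr_ge0 ?(ltW k0) // (le_trans _ p1).
rewrite ret; last by rewrite s0 /=; lra.
rewrite IH ?mulrA ?exprSr ?mulr_ge0 ?(ltW k0) //.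
lra.
Qed.

(** The shortest return time [i] divides [n], and the return dilates the ray.
    As [X] does not have period [i], two of its equal-phase symbols differ;
    then a whole piece of the ray is carried along the switching manifold, and
    the fundamental segment meets the latter in too many points. *)
Lemma no_ray_return r k : (0 < r)%N -> (r < n)%N -> ~ ray_return r k.
Proof.
move=> r0 rn ret.
pose P r := `[< [/\ (0 < r)%N, (r < n)%N & exists k, ray_return r k] >].
have exP : exists r, P r by exists r; apply/asboolP; split=> //; exists k.
case: (ex_minnP exP) => i /asboolP[i0 ilt [kap reti]] imin {r r0 rn k ret exP}.
have [k0 reti'] := reti.
(* [s0] is so small that all the [e] first returns stay within reach of [reti] *)
pose e := (n %/ i)%N; pose s0 := lam / (1 + kap) ^+ e.
have p0 : 0 < (1 + kap) ^+ e by apply: exprn_gt0; lra.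
have s00 : 0 < s0 by apply: divr_gt0.
have s0E : s0 * (1 + kap) ^+ e = lam by rewrite divfK ?gt_eqF.
have kp : kap ^+ e <= (1 + kap) ^+ e by apply: lerXn2r; rewrite ?nnegrE; lra.
have kp0 : 0 < kap ^+ e by apply: exprn_gt0.
have ks1 : kap ^+ e * s0 <= lam by rewrite -s0E mulrC ler_wpM2l // ltW.
have s0l : s0 <= lam.
  by rewrite -s0E ler_peMr ?(ltW s00) // exprn_ege1 // lerDl ltW.
have eqn : iter (n %% i) f (B (kap ^+ e * s0)) = B (s0 / lam).
  rewrite -(ray_return_iter reti) ?s0E ?(ltW s00) // -iterD addnC -divn_eq.
  have := @iter_unstable 1 (s0 / lam); rewrite mul1n expr1 mulrCA mulfV ?gt_eqF //.
  by rewrite mulr1; apply; rewrite divr_ge0 ?(ltW s00) ?(ltW l0) //= ler_pdivrMr ?mul1r.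
have r'0 : (n %% i)%N = 0%N.
  apply/eqP; rewrite -leqn0 leqNgt; apply/negP => r'0.
  have r'i : (n %% i < i)%N by rewrite ltn_pmod.
  suff /imin : P (n %% i)%N by rewrite leqNgt r'i.
  apply/asboolP; split; rewrite ?(ltn_trans r'i) //.
  exists (s0 / lam / (kap ^+ e * s0)); apply: ray_return_of eqn.
  - exact: ltn_trans ilt.
  - by rewrite mulr_gt0 //= (le_trans ks1) ?ltW.
  - by rewrite divr_gt0 //= ler_pdivrMr ?mul1r.
have kE : kap ^+ e = lam^-1.
  move: eqn; rewrite r'0 /= => /(line_inj (unstable_neq0 H)).
  by rewrite [RHS]mulrC => /mulIf; apply; rewrite gt_eqF.
have lV : 1 < lam^-1 by rewrite invf_gt1.
have kap1 : 1 < kap.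
  rewrite ltNge; apply/negP => kap1.
  by have := exprn_ile1 e (ltW k0) kap1; rewrite kE leNgt lV.
have kapl : kap * lam <= 1.
  rewrite -ler_pdivlMr // mul1r -kE.
  have : (0 < e)%N by rewrite divn_gt0 // ltnW.
  case: e {s0 p0 s00 s0E kp kp0 ks1 s0l eqn kE} => // e _; rewrite exprS.
  by rewrite ler_peMr ?(ltW k0) // exprn_ege1 // ltW.
have [j jn Xj] := primitive_aperiodic X_prim i0 ilt (introT eqP r'0 : i %| n)%N.
have jn' : (j < n)%N by apply: leq_ltn_trans jn; rewrite leq_addr.
have shift (s : R) : 0 <= s <= lam ->
    iter (j + i) f (B s) = iter j f (B (kap * s)).
  by move=> s01; rewrite iterD reti'.
(* the point has phase [j + i] along [X] as the image of [B s], and phase [j] as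
   the image of [B (kap * s)] *)
have flat (s : R) : 0 <= s <= lam / kap -> xcoord (iter (j + i) f (B s)) = 0.
  move=> /andP[sge sle].
  have ksle : kap * s <= lam by rewrite mulrC -ler_pdivlMr.
  have sl : s <= lam by move: ksle kap1 sge; nra.
  apply: (side_opp Xj).
    rewrite shift ?sge //.
    have /followsP : follows p X (B (kap * s)).
      by apply: unstable_follows; rewrite ksle mulr_ge0 // ltW.
    by apply.
  have /followsP : follows p X (B s) by apply: unstable_follows; rewrite sge.
  by apply.
have flat' (t : R) : 0 <= t <= kap * lam -> xcoord (iter j f (B t)) = 0.
  move=> /andP[t0 tl].
  have tk : t = kap * (t / kap) by rewrite mulrCA mulfV ?mulr1 ?gt_eqF.
  have s01 : 0 <= t / kap <= lam.
    by rewrite divr_ge0 ?(ltW k0) //= ler_pdivrMr // mulrC.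
  rewrite tk -shift //; move: (t / kap) s01 => s s01.
  have fs := unstable_follows s01; have fl0 := @flat 0; have fl1 := @flat (lam / kap).
  have lk : 0 < lam / kap by apply: divr_gt0.
  have lkl : lam / kap <= lam.
    by rewrite ler_pdivrMr // ler_peMr ?(ltW l0) ?(ltW kap1).
  have fll : follows p X (B (lam / kap)) by apply: unstable_follows; rewrite ltW.
  have f00 : follows p X (B 0) by apply: unstable_follows; rewrite lexx ltW.
  move: fl0 fl1; rewrite !(iter_follows_take _ (ltnW jn)) //.
  rewrite !lexx (ltW lk) => /(_ isT) e0 /(_ isT) e1.
  rewrite (line_comb bv s lk) pieces_comb.
  by move: e0 e1; rewrite /xcoord !mxE => -> ->; rewrite !mulr0 addr0.
have three (t : R) : lam <= t <= kap * lam ->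
    iter j f (B t) = z1 \/ iter j f (B t) = z2.
  move=> /andP[tl tk]; apply: two_points.
  - by rewrite (ltn_trans jn') // -[X in (X < _)%N]addn0 ltn_add2l; case: Y Y_nonempty.
  - by rewrite tl (le_trans tk).
  - by apply: flat'; rewrite tk (le_trans _ tl) // ltW.
have neq (s t : R) : s < t -> iter j f (B s) <> iter j f (B t).
  by move=> st /iter_inj/(line_inj (unstable_neq0 H)) E; rewrite E ltxx in st.
pose t3 := kap * lam; have t13 : lam < t3 by rewrite ltr_pMl.
pose t2 := (lam + t3) / 2.
have t12 : lam < t2 by rewrite /t2; lra.
have t23 : t2 < t3 by rewrite /t2; lra.
have := three lam; have := three t2; have := three t3; rewrite !lexx (ltW t12) (ltW t13).
rewrite (ltW t23) => /(_ isT) h3 /(_ isT) h2 /(_ isT) h1.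
have := neq _ _ t12; have := neq _ _ t13; have := neq _ _ t23.
by case: h1 h2 h3 => -> [] -> [] ->.
Qed.

Lemma unstable_return i (t t' : R) : 0 < t <= 1 -> 0 < t' <= 1 ->
  iter i f (B t) = B t' -> exists2 k, i = (k * n)%N & t = lam ^+ k * t'.
Proof.
move=> t01 t'01; rewrite {1}(divn_eq i n); set k := (i %/ n)%N => ret.
have t'0 : 0 <= t' <= 1 by move: t'01; lra.
have lk : 0 < lam ^+ k <= 1.
  by rewrite exprn_gt0 //= exprn_ile1 // ltW.
have lt' : 0 < lam ^+ k * t' <= 1 by move: lk t'01; nra.
have rE : iter (i %% n) f (B t) = B (lam ^+ k * t').
  by apply: (@iter_inj (k * n)); rewrite -iterD iter_unstable.
have n0 : (0 < n)%N by case: X X_prim => // -[].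
have rn : (i %% n < n)%N by rewrite ltn_pmod.
have [r0|r0] := posnP (i %% n)%N.
  exists k; first by rewrite [LHS](divn_eq i n) r0 addn0.
  by move: rE; rewrite r0 /= => /(line_inj (unstable_neq0 H)).
by case: (no_ray_return r0 rn (ray_return_of rn t01 lt' rE)).
Qed.

(** Injectivity reduces a coincidence to a return of the branch to itself, hence
    to a power of [f^n], and [f^n] multiplies the parameter by [lam^-1]: only
    the two ends of the segment can be identified. *)
Lemma orbit_coincidence i i' (t t' : R) : lam <= t <= 1 -> lam <= t' <= 1 ->
  iter i f (B t) = iter i' f (B t') ->
  [\/ i = i' /\ t = t', [/\ t = lam, t' = 1 & i = (i' + n)%N] |
      [/\ t = 1, t' = lam & i' = (i + n)%N]].
Proof.
wlog ii' : i i' t t' / (i' <= i)%N.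
  move=> W tl tl' E; have [|/ltnW] := leqP i' i; first by move/W; apply.
  move/W => /(_ _ _ tl' tl (esym E)) [[-> ->]|[-> -> ->]|[-> -> ->]].
  - by constructor 1.
  - by constructor 3.
  - by constructor 2.
move=> tl tl'; rewrite -{1}(subnKC ii') iterD => /iter_inj ret.
have [||[|[|k]] ik tk] := unstable_return _ _ ret; try by (move: tl tl' l0; lra).
- by constructor 1; rewrite tk expr0 mul1r; split=> //; lia.
- constructor 2; have t'1 : t' = 1.
    move: tl tl'; rewrite tk expr1; move: l0; nra.
  by split; [rewrite tk t'1 expr1 mulr1|exact: t'1|lia].
- have lk : 0 < lam ^+ k <= 1 by rewrite exprn_gt0 //= exprn_ile1 // ltW.
  move: tl; rewrite tk !exprS => /andP[tl _].
  have l2 : lam * (lam * (lam ^+ k * t')) < lam.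
    rewrite -[ltRHS]mulr1 ltr_pM2l //.
    have : lam ^+ k * t' <= 1 by move: lk tl' l0; nra.
    by move: l0 l1; nra.
  by move: l2; rewrite ltNge !mulrA in tl *; rewrite tl.
Qed.

(** ** The images of the fundamental segment *)

Definition on_stable_axis (z : 'cV[R]_2) := exists s, z = C s.

Lemma on_stable_axis_comb t u v : on_stable_axis u -> on_stable_axis v ->
  on_stable_axis ((1 - t) *: u + t *: v).
Proof.
move=> [a ->] [b ->]; exists ((1 - t) * a + t * b).
by rewrite !scalerDr addrACA -scalerDl subrK scale1r !scalerA -scalerDl.
Qed.

Lemma XY_axis s : on_stable_axis (pieces p (X ++ Y) (B s)).
Proof. by rewrite pieces_cat (X_unstable H); exact: (Y_unstable H). Qed.

Lemma YX_axis s : on_stable_axis (pieces p (Y ++ X) (B s)).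
Proof.
rewrite pieces_cat; have [k ->] := Y_unstable H s.
by rewrite (X_stable H); exists (lam * k).
Qed.

Definition no_hit (s t : R) := forall i (u : R), (i < N)%N -> s < u < t ->
  xcoord (iter i f (B u)) <> 0.

(** The word is read off the midpoint; by the intermediate value theorem no sign
    changes on the open interval, nor becomes strictly wrong at its ends. *)
Lemma no_hit_word (s t : R) : s < t -> no_hit s t ->
  exists2 S, size S = N & forall u, s <= u <= t -> follows p S (B u).
Proof.
move=> st nh; pose c := (s + t) / 2.
have sc : s < c < t by rewrite /c; lra.
pose S := mkseq (fun i => if xcoord (iter i f (B c)) < 0 then SymL else SymR) N.
exists S => [|u su]; first by rewrite size_mkseq.
apply/followsP => i; rewrite size_mkseq => iN; rewrite nth_mkseq //.
set J := if _ then _ else _.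
have cJ : 0 < symb_sign J * xcoord (iter i f (B c)).
  have := nh i c iN sc; rewrite /J; case: (ltgtP (xcoord (iter i f (B c))) 0) => //= h _;
    rewrite ?mul1r ?mulN1r ?oppr_gt0 //.
have [//|uJ] := side_total J (iter i f (B u)).
have cC : ccont (fun v => iter i f (B v)) by apply: ccont_iter; exact: ccont_line.
have hC : continuous (fun v : R => symb_sign J * xcoord (iter i f (B v))).
  move=> v; apply: cvgM; first exact: cvg_cst.
  exact: (cC ord0 v).
have [v /eqP] := sign_change hC uJ cJ.
rewrite gt_min lt_max mulf_eq0 => /orP[/eqP J0|/eqP v0].
  by move: cJ; rewrite J0 mul0r ltxx.
by case/andP=> /orP uv /orP vc; case: (nh i v iN _ v0); move: sc su uv vc; lra.
Qed.

Lemma two_words_differ (S T : word) (z : 'cV[R]_2) : size S = N -> size T = N ->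
  follows p S z -> follows p T z -> S <> T ->
  exists i, [/\ (i < N)%N, nth SymL S i <> nth SymL T i &
    xcoord (iter i f z) = 0].
Proof.
move=> sS sT /followsP fS /followsP fT ST.
apply: contrapT => /forallNP same; case: ST.
apply: (@eq_from_nth _ SymL); rewrite sS ?sT // => i iN.
apply: contrapT => d; apply: (same i); split=> //.
by apply: (side_opp d); [apply: fS; rewrite sS|apply: fT; rewrite sT].
Qed.

Lemma no_hit_axis (s t : R) : s < t -> no_hit s t ->
  on_stable_axis (iter N f (B s)) -> on_stable_axis (iter N f (B t)) ->
  forall u, s <= u <= t -> on_stable_axis (iter N f (B u)).
Proof.
move=> st nh as_ at_ u su; have [S sS fS] := no_hit_word st nh.
have gE v : s <= v <= t -> iter N f (B v) = pieces p S (B v).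
  by move=> /fS fv; rewrite -sS iter_follows.
rewrite gE // (line_comb bv u st) pieces_comb; apply: on_stable_axis_comb.
  by rewrite -gE // lexx ltW.
by rewrite -gE // lexx ltW.
Qed.

Lemma axis_at_a : iter N f (B lam) = C 1.
Proof.
rewrite -size_cat (iter_follows (a_follows H)) pieces_cat (X_unstable H).
by rewrite mulVf ?gt_eqF // !line1; exact: (Y_connects H).
Qed.

Lemma axis_at_b : iter N f (B 1) = C lam.
Proof.
rewrite addnC -size_cat line1 (iter_follows (b_follows H)) pieces_cat.
by rewrite (Y_connects H) -line1 (X_stable H) mulr1.
Qed.

(** Were the itinerary wrong next to both ends, the point responsible would be
    the same at both, since one of the two points of the switching manifold is
    taken by [t]. So the first coordinate of [f^i'] would have the same strict sign
    on both sides of [b], where it vanishes, although it is affine across [b]. *)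
Lemma one_end_good t it S i S' i' : lam < t < 1 -> no_hit t 1 ->
  (it < N)%N -> xcoord (iter it f (B t)) = 0 ->
  size S = N -> (forall u, lam <= u <= t -> follows p S (B u)) ->
  (i < N)%N -> nth SymL S i <> nth SymL (X ++ Y) i ->
  xcoord (iter i f (B lam)) = 0 ->
  size S' = N -> (forall u, t <= u <= 1 -> follows p S' (B u)) ->
  (i' < N)%N -> nth SymL S' i' <> nth SymL (Y ++ X) i' ->
  xcoord (iter i' f (B 1)) = 0 -> False.
Proof.
move=> tI nh itN t0 sS fS iN Si i0 sS' fS' i'N S'i i'0.
have lamI : lam <= lam <= 1 by rewrite lexx ltW.
have oneI : lam <= (1 : R) <= 1 by rewrite lexx ltW.
have tI' : lam <= t <= 1 by move: tI; lra.
have off_lam k : iter k f (B lam) <> iter it f (B t).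
  by move=> /orbit_coincidence[] // [] *; move: tI l1; lra.
have off_one k : iter k f (B 1) <> iter it f (B t).
  by move=> /orbit_coincidence[] // [] *; move: tI l1; lra.
have pair j k : (j < N)%N -> (k < N)%N -> xcoord (iter j f (B lam)) = 0 ->
    xcoord (iter k f (B 1)) = 0 -> j = (k + n)%N.
  move=> jN kN j0 k0.
  have : iter j f (B lam) = iter k f (B 1).
    have := off_lam j; have := off_one k.
    have [-> | ->] := two_points jN lamI j0;
    have [-> | ->] := two_points kN oneI k0;
    by have [-> | ->] := two_points itN tI' t0.
  by case/orbit_coincidence => // [[_ E]|[_ _ E]|[E _ _]] //; exfalso; move: l1; lra.
(* from here on, [i] is the time at which the orbit of [a] reaches [f^i'(b)] *)
have ii' := pair _ _ iN i'N i0 i'0.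
have i'm : (i' < size Y)%N by move: iN; rewrite ii' addnC ltn_add2l.
pose V := take i' Y.
have pre : take i S = X ++ V.
  have -> : X ++ V = take i (X ++ Y).
    by rewrite take_cat ltnNge ii' leq_addl /= addnK.
  apply: (@eq_from_nth _ SymL); rewrite !size_takel ?sS ?size_cat ?(ltnW iN) //.
  move=> k ki; rewrite !nth_take //; apply: contrapT => d.
  have kN := ltn_trans ki iN.
  suff kE : k = (i' + n)%N by move: ki; rewrite ii' kE ltnn.
  apply: pair => //; apply: (side_opp d).
    by have /followsP := fS lam (ltac:(move: tI; lra)); apply; rewrite sS.
  by have /followsP := a_follows H; apply; rewrite size_cat.
have pre' : take i' S' = V.
  apply: (@eq_from_nth _ SymL); rewrite !size_takel ?sS' ?(ltnW i'N) ?(ltnW i'm) //.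
  move=> k ki; rewrite !nth_take //; apply: contrapT => d.
  have kN := ltn_trans ki i'N.
  suff iE : i = (k + n)%N by move: ki; rewrite -(ltn_add2r n) -iE ii' ltnn.
  apply: pair => //; apply: (@side_opp _ _ _ _ d).
    by have /followsP := fS' 1 (ltac:(move: tI; lra)); apply; rewrite sS'.
  rewrite line1; have /followsP/(_ k) := b_follows H; rewrite nth_cat size_cat.
  by rewrite (ltn_trans ki i'm) addnC; exact.
have SiE : nth SymL S i = nth SymL S' i'.
  move: Si S'i; rewrite !nth_cat i'm ltnNge ii' leq_addl /= addnK.
  by case: (nth _ _ _) (nth _ _ _) (nth _ _ _) => [] [] [].
(* the first coordinate of [f^i'] along the axis, with the sign that is wrong
   for the word *)
have [al [be AE]] : exists al be : R, forall v,
    symb_sign (nth SymL S' i') * xcoord (pieces p V (B v)) = al + be * v.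
  pose K : R := symb_sign (nth SymL S' i').
  exists (K * xcoord (pieces p V w0)), (K * xcoord (word_mx p V *m bv)) => v.
  rewrite pieces_add -scalemxAr; move: (pieces p V w0) (word_mx p V *m bv) => P G.
  by rewrite /xcoord !mxE /K; ring.
have right u : t <= u <= 1 -> iter i' f (B u) = pieces p V (B u).
  by move=> /fS' fu; rewrite (iter_follows_take fu) ?sS' ?(ltnW i'N) // pre'.
have A1 : al + be = 0.
  by rewrite -[be]mulr1 -AE -right ?i'0 ?mulr0 //; move: tI; lra.
have At : 0 <= al + be * t.
  have tt : t <= t <= 1 by move: tI; lra.
  rewrite -AE -right //; have /followsP := fS' _ tt; apply; by rewrite sS'.
have Atl : 0 <= al + be * (lam^-1 * t).
  have tt : lam <= t <= t by move: tI; lra.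
  rewrite -AE -(X_unstable H) -pieces_cat -pre -SiE.
  rewrite -(iter_follows_take (fS _ tt)) ?sS ?(ltnW iN) //.
  by have /followsP := fS _ tt; apply; rewrite sS.
have be0 : be = 0.
  have lt1 : 1 < lam^-1 * t by rewrite mulrC ltr_pdivlMr ?mul1r //; case/andP: tI.
  by move: A1 At Atl tI lt1; nra.
have mI : t < (t + 1) / 2 < 1 by move: tI; lra.
apply: (nh i' ((t + 1) / 2) i'N mI).
apply/eqP; rewrite right; last by move: mI; lra.
have /eqP := AE ((t + 1) / 2).
have -> : al = 0 by move: A1; rewrite be0; lra.
rewrite be0 mul0r addr0 mulf_eq0 => /orP[|//].
by case: (nth _ _ _) => /=; rewrite ?oppr_eq0 oner_eq0.
Qed.

Lemma left_end t : lam < t <= 1 -> no_hit lam t ->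
  (forall u, lam <= u <= t -> on_stable_axis (iter N f (B u))) \/
  exists S i, [/\ size S = N, forall u, lam <= u <= t -> follows p S (B u),
    (i < N)%N, nth SymL S i <> nth SymL (X ++ Y) i &
    xcoord (iter i f (B lam)) = 0].
Proof.
move=> /andP[lt t1] nh; have [S sS fS] := no_hit_word lt nh.
have [SE|SE] := pselect (S = X ++ Y).
  left=> u /fS fu; rewrite -sS (iter_follows fu) SE; exact: XY_axis.
right; have sXY : size (X ++ Y) = N by rewrite size_cat.
have ll : lam <= lam <= t by rewrite lexx ltW.
have [i [iN Si i0]] := two_words_differ sS sXY (fS _ ll) (a_follows H) SE.
by exists S, i.
Qed.

Lemma right_end t : lam <= t < 1 -> no_hit t 1 ->
  (forall u, t <= u <= 1 -> on_stable_axis (iter N f (B u))) \/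
  exists S i, [/\ size S = N, forall u, t <= u <= 1 -> follows p S (B u),
    (i < N)%N, nth SymL S i <> nth SymL (Y ++ X) i &
    xcoord (iter i f (B 1)) = 0].
Proof.
move=> /andP[lt t1] nh; have [S sS fS] := no_hit_word t1 nh.
have [SE|SE] := pselect (S = Y ++ X).
  left=> u /fS fu; rewrite -sS (iter_follows fu) SE; exact: YX_axis.
right; have sYX : size (Y ++ X) = N by rewrite size_cat addnC.
have ll : t <= (1 : R) <= 1 by rewrite lexx ltW.
have fb : follows p (Y ++ X) (B 1) by rewrite line1; exact: (b_follows H).
have [i [iN Si i0]] := two_words_differ sS sYX (fS _ ll) fb SE.
by exists S, i.
Qed.

(** The affine pieces of [f^N] on the fundamental segment are separated by at
    most two parameters. The outer pieces are prescribed by [X ++ Y] and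
    [Y ++ X], both of which map the unstable axis into the stable one, and a
    middle piece joins two points of that axis. *)
Lemma image_on_axis s : lam <= s <= 1 -> on_stable_axis (iter N f (B s)).
Proof.
have aA : on_stable_axis (iter N f (B lam)) by rewrite axis_at_a; exists 1.
have bA : on_stable_axis (iter N f (B 1)) by rewrite axis_at_b; exists lam.
pose hit t := exists2 i, (i < N)%N & xcoord (iter i f (B t)) = 0.
have [[t tI [it itN t0]]|no] := pselect (exists2 t, lam < t < 1 & hit t); last first.
  apply: no_hit_axis => // i u iN uI u0; apply: no; exists u => //; by exists i.
have [[t' [t'I t't [it' it'N t'0]]]|no] :=
    pselect (exists t', [/\ lam < t' < 1, t' <> t & hit t']); last first.
  have nhl : no_hit lam t.
    move=> i u iN uI u0; apply: no; exists u; split; last by exists i.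
      by move: tI uI; lra.
    by move=> ut; move: uI; rewrite ut ltxx andbF.
  have nhr : no_hit t 1.
    move=> i u iN uI u0; apply: no; exists u; split; last by exists i.
      by move: tI uI; lra.
    by move=> ut; move: uI; rewrite ut ltxx.
  have tl : lam < t <= 1 by move: tI; lra.
  have tr : lam <= t < 1 by move: tI; lra.
  have [lt t1] := andP tI.
  move=> /andP[ls s1].
  have [lA|[S [i [sS fS iN Si i0]]]] := left_end tl nhl.
    have [st|/ltW ts] := leP s t; first by apply: lA; rewrite ls.
    apply: (no_hit_axis t1 nhr _ bA); last by rewrite ts.
    by apply: lA; rewrite ltW //= lexx.
  have [rA|[S' [i' [sS' fS' i'N S'i i'0]]]] := right_end tr nhr.
    have [st|/ltW ts] := leP s t; last by apply: rA; rewrite ts.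
    apply: (no_hit_axis lt nhl aA); last by rewrite ls.
    by apply: rA; rewrite lexx ltW.
  by case: (one_end_good tI nhr itN t0 sS fS iN Si i0 sS' fS' i'N S'i i'0).
wlog tt' : t t' it it' tI itN t0 t'I t't it'N t'0 / t < t'.
  move=> W; have [tt'|t't'|E] := ltgtP t t'; last by case: t't.
    exact: (W t t' it it').
  by apply: (W t' t it' it) => // E; apply: t't.
have tI' : lam <= t <= 1 by move: tI; lra.
have t'I' : lam <= t' <= 1 by move: t'I; lra.
have tne : iter it f (B t) <> iter it' f (B t').
  by move=> /orbit_coincidence[] // [] *; move: tI t'I tt'; lra.
have only i u : (i < N)%N -> lam <= u <= 1 -> xcoord (iter i f (B u)) = 0 ->
    u = t \/ u = t'.
  move=> iN uI u0.
  have : iter i f (B u) = iter it f (B t) \/ iter i f (B u) = iter it' f (B t').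
    move: tne; have [-> | ->] := two_points iN uI u0;
    have [-> | ->] := two_points itN tI' t0;
    by have [-> | ->] := two_points it'N t'I' t'0; auto.
  case=> [/(orbit_coincidence uI tI')|/(orbit_coincidence uI t'I')];
    case=> [[_ E]|[_ E _]|[_ E _]].
  - by left.
  - by exfalso; move: tI; lra.
  - by exfalso; move: tI; lra.
  - by right.
  - by exfalso; move: t'I; lra.
  - by exfalso; move: t'I; lra.
have [lt t1] := andP tI; have [lt' t'1] := andP t'I.
have nhl : no_hit lam t.
  by move=> i u iN uI /only[]//; [move: uI tI; lra|move: uI tt'; lra|move: uI tt'; lra].
have nhm : no_hit t t'.
  by move=> i u iN uI /only[]//; [move: uI tI t'I; lra|move: uI tt'; lra|move: uI tt'; lra].
have nhr : no_hit t' 1.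
  by move=> i u iN uI /only[]//; [move: uI t'I; lra|move: uI tt'; lra|move: uI tt'; lra].
have lA : forall u, lam <= u <= t -> on_stable_axis (iter N f (B u)).
  have [|//|[S [i [_ _ iN _ /only[]]]]] := left_end _ nhl => //.
  - by rewrite lt ltW.
  - by rewrite lexx ltW.
  - by move: lt; lra.
  - by move: lt'; lra.
have rA : forall u, t' <= u <= 1 -> on_stable_axis (iter N f (B u)).
  have [|//|[S [i [_ _ iN _ /only[]]]]] := right_end _ nhr => //.
  - by rewrite t'1 ltW.
  - by rewrite lexx ltW.
  - by move: t1; lra.
  - by move: t'1; lra.
move=> /andP[ls s1].
have [st|/ltW ts] := leP s t; first by apply: lA; rewrite ls.
have [st'|/ltW t's] := leP s t'; last by apply: rA; rewrite t's.
apply: (no_hit_axis tt' nhm); last by rewrite ts.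
  by apply: lA; rewrite lexx ltW.
by apply: rA; rewrite lexx ltW.
Qed.

(** A continuous injective map of an interval into a line that sends ends to
    ends is onto the segment between them. *)
Lemma image_segment z :
  (exists2 s, lam <= s <= 1 & iter N f (B s) = z) <->
  (exists2 t, lam <= t <= 1 & z = C t).
Proof.
have [i cvi] : exists i, cv i ord0 <> 0.
  apply: contrapT => /forallNP cv0; apply: (stable_neq0 H).
  by apply/matrixP => i j; rewrite (ord1 j) mxE; apply: contrapT => /cv0.
pose th s := (iter N f (B s) i ord0 - w0 i ord0) / cv i ord0.
have thE s t : iter N f (B s) = C t -> th s = t.
  by move=> E; rewrite /th E !mxE addrAC subrr add0r mulfK //; apply/eqP.
have thC s : lam <= s <= 1 -> iter N f (B s) = C (th s).
  by move=> /image_on_axis[t E]; rewrite E (thE _ _ E).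
have cC : ccont (fun v => iter N f (B v)) by apply: ccont_iter; exact: ccont_line.
have thcont : continuous th.
  move=> s; apply: cvgM; last exact: cvg_cst.
  apply: cvgB; last exact: cvg_cst.
  exact: (cC i s).
have thinj s t : lam <= s <= 1 -> lam <= t <= 1 -> th s = th t -> s = t.
  move=> sI tI E; apply: (line_inj (unstable_neq0 H)).
  by apply: (@iter_inj N); rewrite !thC // E.
have tha := thE _ _ axis_at_a; have thb := thE _ _ axis_at_b.
have thcont' a b : {within `[a, b], continuous th}%classic.
  by apply: continuous_subspaceT => x; exact: thcont.
split=> [[s sI <-]|[t tI ->]]; last first.
  have [|s] := @IVT _ th lam 1 t (ltW l1) (thcont' _ _).
    by rewrite tha thb ge_min le_max; move: tI => /andP[-> ->]; rewrite orbT.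
  by rewrite in_itv /= => sI st; exists s => //; rewrite thC // st.
exists (th s); last exact: thC.
have [ls s1] := andP sI.
rewrite leNgt [_ <= 1]leNgt; apply/andP; split; apply/negP => bad.
  have [|v vI vE] := @IVT _ th lam s lam ls (thcont' _ _).
    by rewrite tha ge_min le_max (ltW l1) (ltW bad) orbT.
  move: vI; rewrite in_itv /= => /andP[lv vs].
  have v1 : v = 1 by apply: thinj; rewrite ?vE ?thb ?lv ?(le_trans vs) // lexx ltW.
  have s1' : s = 1 by apply/eqP; rewrite eq_le s1 -v1.
  by move: bad; rewrite s1' thb ltxx.
have [|v vI vE] := @IVT _ th s 1 1 s1 (thcont' _ _).
  by rewrite thb ge_min le_max (ltW l1) (ltW bad) orbT.
move: vI; rewrite in_itv /= => /andP[sv v1].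
have vl : v = lam.
  apply: thinj; last by rewrite vE tha.
    by rewrite v1 (le_trans ls sv).
  by rewrite lexx ltW.
have sl : s = lam by apply/eqP; rewrite eq_le ls -vl sv.
by move: bad; rewrite sl tha ltxx.
Qed.
End Connection.

(** * The numbers forced by infinitely many stable cycles *)

Lemma infinite_frequently (G : set nat) (P : nat -> Prop) :
  infinite_set G -> (\forall k \near \oo, P k) -> exists2 k, G k & P k.
Proof.
move=> Ginf [K _ KP]; apply: contrapT => no; apply: Ginf.
apply: (@sub_finite_set _ _ `I_K); last exact: finite_II.
move=> k Gk /=; rewrite ltnNge; apply/negP => Kk.
by apply: no; exists k => //; exact: KP.
Qed.

Section Numbers.
Context {R : realType}.

Let cvg_pow0 (a : R) : 0 < a < 1 -> (fun k => a ^+ k) @ \oo --> (0 : R).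
Proof. by move=> /andP[a0 a1]; apply: cvg_expr; rewrite gtr0_norm. Qed.

(** All the sequences compared below have this form in two null sequences. *)
Let bilinear (x y : nat -> R) (a b c d : R) k := a + b * x k + c * y k + d * (x k * y k).

Let near_pos (x y : nat -> R) (a b c d a' b' c' d' : R) :
  x @ \oo --> (0 : R) -> y @ \oo --> (0 : R) -> 0 < a * a' ->
  \forall k \near \oo, 0 < bilinear x y a b c d k * bilinear x y a' b' c' d' k.
Proof.
move=> x0 y0 aa.
have lim (e f g h : R) : bilinear x y e f g h @ \oo --> e.
  rewrite -[X in _ --> X]addr0 -[X in _ --> X + _]addr0 -[X in _ --> X + _ + _]addr0.
  have cM (v : R) (z : nat -> R) : z @ \oo --> (0 : R) -> (fun k => v * z k) @ \oo --> (0 : R).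
    by move=> z0; rewrite -(mulr0 v); apply: cvgM => //; exact: cvg_cst.
  apply: cvgD; last by apply: (cM h); rewrite -(mulr0 0); exact: cvgM.
  apply: cvgD; last exact: cM.
  by apply: cvgD; [exact: cvg_cst|exact: cM].
exact: (cvgr_gt _ (cvgM (lim a b c d) (lim a' b' c' d')) 0 aa).
Qed.

(** [xa] and [xb] are the first coordinates of the points of the cycle of [X^k Y]
    after [k - 1] and [k] turns of [X], which are on opposite sides of the
    switching manifold. Bounded traces and determinants give [g22 = 0] and [l1 * l2 <= 1]. If [s2] were not
    [0], both coordinates would be dominated by positive multiples of
    [s2 * e2 * l2 ^+ k] up to a common sign; if [l1 * l2 < 1], both would be close
    to [x0] or, when [x0 = 0], dominated by positive multiples of
    [g21 * s1 * e2 * (l1 * l2) ^+ k] up to a common sign. If [s1] were [0], the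
    cycle would sit at the saddle point, which would then lie on the switching
    manifold. Finally [g12 * g21 = 1] makes the determinant [-1], the bound on the
    trace of the square makes the trace [0], and the cycle is not unique. *)
Lemma homoclinic_numbers (G : set nat) (l1 l2 g11 g12 g21 g22 s1 s2 x0 e1 e2 : R) :
  infinite_set G -> 0 < l1 < 1 -> 1 < l2 -> e2 <> 0 ->
  g11 * g22 - g12 * g21 <> 0 ->
  (forall k, G k ->
    let tr := g11 * l1 ^+ k + g22 * l2 ^+ k in
    let dt := (l1 * l2) ^+ k * (g11 * g22 - g12 * g21) in
    [/\ `|tr| <= 2, `|dt| <= 1, tr ^+ 2 - 2 * dt <= 2, 1 - tr + dt <> 0 &
     exists u v,
       let xa := x0 + l1 ^+ k / l1 * u * e1 + l2 ^+ k / l2 * v * e2 in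
       let xb := x0 + l1 ^+ k * u * e1 + l2 ^+ k * v * e2 in
       [/\ u = g11 * (l1 ^+ k * u) + g12 * (l2 ^+ k * v) + s1,
           v = g21 * (l1 ^+ k * u) + g22 * (l2 ^+ k * v) + s2,
           xa * xb <= 0 & xb <> 0]]) ->
  [/\ g22 = 0, l1 * l2 = 1, g12 * g21 <> 1, s2 = 0 & s1 <> 0].
Proof.
move=> Ginf l1I l21 e20 dg0 HG.
have [l10 l11] := andP l1I; have l20 : 0 < l2 by exact: lt_trans l21.
have freq := infinite_frequently Ginf.
pose q k : R := l1 ^+ k; pose r k : R := l2^-1 ^+ k.
have q0 : q @ \oo --> (0 : R) by exact: cvg_pow0.
have r0 : r @ \oo --> (0 : R).
  by apply: cvg_pow0; rewrite invr_gt0 l20 invf_lt1.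
have rgt k : 0 < r k by rewrite exprn_gt0 ?invr_gt0.
have rE k : r k * l2 ^+ k = 1 by rewrite -exprMn mulVf ?gt_eqF ?expr1n.
have g220 : g22 = 0.
  apply: contrapT => g22N.
  have lim0 : (fun k => (2 + `|g11|) * r k) @ \oo --> (2 + `|g11|) * 0.
    by apply: cvgM => //; exact: cvg_cst.
  have near_small : \forall k \near \oo, (2 + `|g11|) * r k < `|g22|.
    by apply: (cvgr_lt _ lim0); rewrite mulr0 normr_gt0; apply/eqP.
  have [k /HG[+ _ _ _ _] small] := freq _ near_small.
  have q1 : 0 <= q k <= 1 by rewrite exprn_ge0 ?exprn_ile1 // ltW.
  have : `|g22| = r k * `|g22 * l2 ^+ k|.
    by rewrite normrM (gtr0_norm (exprn_gt0 _ l20)) mulrCA rE mulr1.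
  have : `|g22 * l2 ^+ k| <= `|g11 * q k + g22 * l2 ^+ k| + `|g11|.
    have := ler_normB (g11 * q k + g22 * l2 ^+ k) (g11 * q k).
    rewrite addrAC subrr add0r => /le_trans; apply; rewrite lerD2l normrM.
    by rewrite (ger0_norm (andP q1).1) ler_piMr // (andP q1).2.
  rewrite -/(q k); move: (rgt k) small; nra.
rewrite {}g220 in dg0 HG *; rewrite mulr0 sub0r in dg0 HG.
set g := g12 * g21 in dg0 HG *.
have g0 : g != 0 by apply/eqP => g0; apply: dg0; rewrite g0 oppr0.
have ll0 : 0 < l1 * l2 by rewrite mulr_gt0.
have ll1 : l1 * l2 <= 1.
  rewrite leNgt; apply/negP => ll1.
  have i0 : (fun k => (l1 * l2)^-1 ^+ k) @ \oo --> (0 : R).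
    by apply: cvg_pow0; rewrite invr_gt0 ll0 invf_lt1.
  have near_small : \forall k \near \oo, (l1 * l2)^-1 ^+ k < `|g|.
    by apply: (cvgr_lt _ i0); rewrite normr_gt0.
  have [k /HG[_ + _ _ _]] := freq _ near_small.
  rewrite normrM normrN (gtr0_norm (exprn_gt0 _ ll0)) exprVn.
  by rewrite -ler_pdivlMl ?exprn_gt0 // mulr1 leNgt => /negP.
pose D k := 1 - g11 * q k - g * (l1 * l2) ^+ k.
pose xa k u v := x0 + l1 ^+ k / l1 * u * e1 + l2 ^+ k / l2 * v * e2.
pose xb k u v := x0 + l1 ^+ k * u * e1 + l2 ^+ k * v * e2.
(* the fixed-point equations solved by Cramer's rule *)
have solve k : G k -> D k <> 0 /\ exists u v,
    [/\ u * D k = g12 * s2 * l2 ^+ k + s1,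
        l2 ^+ k * v * D k = g21 * s1 * (l1 * l2) ^+ k + s2 * l2 ^+ k * (1 - g11 * q k),
        xa k u v * xb k u v <= 0 & xb k u v <> 0].
  move=> /HG[_ _ _ DN [u [v [uE vE xx x1]]]]; split.
    by move=> D0; apply: DN; rewrite -[RHS]D0 /D /q; ring.
  have uD : u * D k = g12 * s2 * l2 ^+ k + s1.
    have : u = g11 * (l1 ^+ k * u) +
        g12 * (l2 ^+ k * (g21 * (l1 ^+ k * u) + s2)) + s1.
      by rewrite [LHS]uE [in LHS]vE; ring.
    by rewrite /D /q exprMn /g; lra.
  exists u, v; split=> //.
  have -> : l2 ^+ k * v * D k = g21 * (l1 * l2) ^+ k * (u * D k) +
      l2 ^+ k * s2 * D k by rewrite {1}vE exprMn; ring.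
  by rewrite uD /D /q exprMn /g; ring.
have s20 : s2 = 0.
  apply: contrapT => s2N.
  pose d k := r k - g11 * (q k * r k) - g * q k.
  pose t1 k := q k * e1 * (g12 * s2 + s1 * r k).
  pose t2 k := e2 * (g21 * s1 * q k + s2 * (1 - g11 * q k)).
  pose c1 := g21 * s1 - s2 * g11.
  have := @near_pos q r
    (e2 * s2 / l2) (- g * x0 + e1 * g12 * s2 / l1 + e2 * c1 / l2) x0 (- g11 * x0 + e1 * s1 / l1)
    (e2 * s2) (- g * x0 + e1 * g12 * s2 + e2 * c1) x0 (- g11 * x0 + e1 * s1) q0 r0.
  move=> /(_ _)/freq[|k /solve[_ [u [v [uE vE xx _]]]]].
    by rewrite mulrAC -expr2 divr_gt0 // exprn_even_gt0 //= mulf_neq0 //; apply/eqP.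
  have -> : bilinear q r (e2 * s2 / l2) (- g * x0 + e1 * g12 * s2 / l1 + e2 * c1 / l2)
      x0 (- g11 * x0 + e1 * s1 / l1) k = d k * x0 + t1 k / l1 + t2 k / l2.
    by rewrite /bilinear /d /t1 /t2 /c1; ring.
  have -> : bilinear q r (e2 * s2) (- g * x0 + e1 * g12 * s2 + e2 * c1) x0
      (- g11 * x0 + e1 * s1) k = d k * x0 + t1 k + t2 k.
    by rewrite /bilinear /d /t1 /t2 /c1; ring.
  have rD : r k * D k = d k.
    rewrite /D /d exprMn -/(q k) -[l2 ^+ k]mulr1.
    have -> : r k * (1 - g11 * q k - g * (q k * (l2 ^+ k * 1))) =
      r k - g11 * (q k * r k) - g * q k * (r k * l2 ^+ k) by ring.
    by rewrite rE mulr1.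
  have ru : r k * (u * D k) = g12 * s2 + s1 * r k.
    by rewrite uE mulrDr mulrCA rE mulr1 (mulrC (r k)).
  have rv : r k * (l2 ^+ k * v * D k) = g21 * s1 * q k + s2 * (1 - g11 * q k).
    rewrite vE exprMn -/(q k).
    have -> : r k * (g21 * s1 * (q k * l2 ^+ k) + s2 * l2 ^+ k * (1 - g11 * q k)) =
      (r k * l2 ^+ k) * (g21 * s1 * q k + s2 * (1 - g11 * q k)) by ring.
    by rewrite rE mul1r.
  have -> : d k * x0 + t1 k + t2 k = r k * D k * xb k u v.
    by rewrite -rD /t1 /t2 -ru -rv /xb /q; ring.
  have -> : d k * x0 + t1 k / l1 + t2 k / l2 = r k * D k * xa k u v.
    by rewrite -rD /t1 /t2 -ru -rv /xa /q; ring.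
  rewrite mulrACA -expr2 ltNge => /negP; apply.
  by rewrite mulr_ge0_le0 ?sqr_ge0.
rewrite {}s20 in solve HG *.
have {}solve k : G k -> D k <> 0 /\ exists u v,
    [/\ u * D k = s1, l2 ^+ k * v * D k = g21 * s1 * (l1 * l2) ^+ k,
        xa k u v * xb k u v <= 0 & xb k u v <> 0].
  move=> /solve[DN [u [v [uE vE xx x1]]]]; split=> //; exists u, v.
  by rewrite uE vE; split=> //; ring.
have s10 : s1 <> 0.
  move=> s10; have [k Gk] := infinite_setN0 Ginf.
  have [/eqP DN [u [v [uE vE xx x1]]]] := solve k Gk; move: uE vE xx x1.
  rewrite s10 mulr0 mul0r => /eqP; rewrite mulf_eq0 (negPf DN) orbF => /eqP u0.
  move=> /eqP; rewrite mulf_eq0 (negPf DN) orbF => /eqP v0.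
  rewrite /xa /xb u0 v0 (mulrAC _ l2^-1) v0 !mulr0 !mul0r !addr0 => xx x1.
  by apply: x1; apply/eqP; rewrite -sqrf_eq0 eq_le sqr_ge0 andbT expr2.
have g21N : g21 != 0 by apply: contraNneq g0 => E; rewrite /g E mulr0.
have ll : l1 * l2 = 1.
  apply/eqP; rewrite eq_le ll1 leNgt; apply/negP => lt1.
  pose t k := (l1 * l2) ^+ k.
  have t0 : t @ \oo --> (0 : R) by apply: cvg_pow0; rewrite ll0.
  have tgt k : 0 < t k by rewrite exprn_gt0.
  have qrt k : q k = r k * t k by rewrite /t exprMn mulrCA rE mulr1.
  have [x00|/eqP x00] := eqVneq x0 0.
    have := @near_pos r r (s1 * g21 * e2 / l2) (s1 * e1 / l1) 0 0
      (s1 * g21 * e2) (s1 * e1) 0 0 r0 r0.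
    move=> /(_ _)/freq[|k /solve[_ [u [v [uE vE xx _]]]]].
      by rewrite mulrAC -expr2 divr_gt0 // exprn_even_gt0 //= !mulf_neq0 //; apply/eqP.
    rewrite ltNge => /negP; apply; rewrite -(pmulr_rle0 _ (exprn_gt0 2 (tgt k))).
    rewrite /bilinear.
    have -> : t k ^+ 2 * ((s1 * g21 * e2 / l2 + s1 * e1 / l1 * r k + 0 * r k + 0 * (r k * r k)) *
      (s1 * g21 * e2 + s1 * e1 * r k + 0 * r k + 0 * (r k * r k))) =
      D k ^+ 2 * (xa k u v * xb k u v).
      have -> : D k ^+ 2 * (xa k u v * xb k u v) =
        (q k / l1 * (u * D k) * e1 + (l2 ^+ k * v * D k) / l2 * e2) *
        (q k * (u * D k) * e1 + (l2 ^+ k * v * D k) * e2).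
        by rewrite /xa /xb x00 /q; ring.
      by rewrite uE vE qrt -/(t k); ring.
    by rewrite mulr_ge0_le0 ?sqr_ge0.
  have := @near_pos q t x0 (- g11 * x0 + s1 * e1 / l1) (- g * x0 + g21 * s1 * e2 / l2) 0
    x0 (- g11 * x0 + s1 * e1) (- g * x0 + g21 * s1 * e2) 0 q0 t0.
  move=> /(_ _)/freq[|k /solve[_ [u [v [uE vE xx _]]]]].
    by rewrite -expr2 exprn_even_gt0 //=; apply/eqP.
  rewrite ltNge => /negP; apply; rewrite /bilinear.
  set LHS := _ * _; have -> : LHS = D k ^+ 2 * (xa k u v * xb k u v).
    have -> : D k ^+ 2 * (xa k u v * xb k u v) =
      (D k * x0 + q k / l1 * (u * D k) * e1 + (l2 ^+ k * v * D k) / l2 * e2) *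
      (D k * x0 + q k * (u * D k) * e1 + (l2 ^+ k * v * D k) * e2).
      by rewrite /xa /xb /q; ring.
    by rewrite uE vE /LHS /D -/(t k); ring.
  by rewrite mulr_ge0_le0 ?sqr_ge0.
split=> // g1; have [k Gk] := infinite_setN0 Ginf.
have [_ _ + DN _] := HG k Gk; rewrite g1 ll expr1n in DN *.
move=> tr2; apply: DN.
have : (g11 * l1 ^+ k + 0 * l2 ^+ k) ^+ 2 <= 0 by move: tr2; lra.
rewrite le_eqVlt ltNge sqr_ge0 orbF sqrf_eq0 => /eqP ->; ring.
Qed.
End Numbers.

(** * Cycles and fixed points *)

Section Cycles.
Context {R : realType} (p : bcnf R).
Implicit Types (z h : 'cV[R]_2) (S : word) (w : nat -> 'cV[R]_2).

Local Notation f := (bcmap p).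

Lemma pieces_rcons S k z : (k < size S)%N ->
  pieces p (take k.+1 S) z = piece p (nth SymL S k) (pieces p (take k S) z).
Proof. by move=> kS; rewrite (take_nth SymL kS) -cats1 pieces_cat. Qed.

Lemma cycle_pieces S w k : is_cycle p S w -> (k <= size S)%N ->
  w k = pieces p (take k S) (w 0%N).
Proof.
move=> cw; elim: k => [|k IH] kS; first by rewrite take0.
by rewrite pieces_rcons // -IH ?(ltnW kS) // (cw k).1 /symb modn_small.
Qed.

Lemma cycle_fixed S w : is_cycle p S w -> pieces p S (w 0%N) = w 0%N.
Proof.
move=> cw; rewrite -{1}[S]take_size -cycle_pieces //.
by have := (cw 0%N).2; rewrite add0n.
Qed.

Lemma fixed_cycle S z : S <> [::] -> pieces p S z = z ->
  exists2 w, is_cycle p S w & w 0%N = z.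
Proof.
move=> S0 fz; have n0 : (0 < size S)%N by case: S S0 {fz}.
exists (fun i => pieces p (take (i %% size S) S) z); last by rewrite mod0n take0.
move=> i; split; last by rewrite modnDr.
have jn : (i %% size S < size S)%N by rewrite ltn_pmod.
have mE : (i.+1 %% size S = (i %% size S).+1 %% size S)%N.
  by rewrite -addn1 -modnDml addn1.
rewrite /symb -pieces_rcons // mE.
move: jn; rewrite leq_eqVlt => /orP[/eqP ->|jn]; last by rewrite modn_small.
by rewrite modnn take0 take_size.
Qed.

(** Cycles are determined by their base points, the fixed points of the affine
    map of the word. *)
Lemma cycle_pt_fixed S z k : S <> [::] -> pieces p S z = z ->
  (forall z', pieces p S z' = z' -> z' = z) -> (k <= size S)%N ->
  cycle_pt p S k = pieces p (take k S) z.
Proof.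
move=> S0 fz uz kS; have [w cw _] := fixed_cycle S0 fz.
have cp : is_cycle p S (cycle_pt p S) by apply: getPex; exists w.
by rewrite (cycle_pieces cp) // (uz _ (cycle_fixed cp)).
Qed.

Lemma good_cycle_point S : S <> [::] -> has_good_cycle p S -> exists z,
  [/\ pieces p S z = z, forall z', pieces p S z' = z' -> z' = z,
      follows p S z,
      forall i, (i < size S)%N -> xcoord (pieces p (take i S) z) <> 0 &
      lyapunov_stable f z].
Proof.
move=> S0 [w [[cw uw] aw sw nw]]; exists (w 0%N).
have sideS i : side (symb S i) (w i).
  by have := aw i; rewrite /side; case: (symb S i) => /=; lra.
have iterE i : iter i f (w 0%N) = w i.
  by elim: i => //= i ->; rewrite (bcmap_side _ (sideS i)) (cw i).1.
split=> //.
- exact: cycle_fixed.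
- move=> z' /(fixed_cycle S0)[w' cw' <-].
  by rewrite (uw _ cw').
- by apply/followsP => i iS; have := sideS i; rewrite iterE /symb modn_small.
- by move=> i iS; rewrite -(cycle_pieces cw (ltnW iS)); exact: nw.
Qed.

(** ** Stability bounds the trace and the determinant *)

Lemma norm_coord z i : `|z i ord0| <= `|z|.
Proof.
rewrite [leRHS]/Num.norm /= mx_normrE; apply/bigmax_geP; right => /=.
by exists (i, ord0).
Qed.

Lemma norm_le z (c : R) : 0 <= c -> (forall i, `|z i ord0| <= c) -> `|z| <= c.
Proof.
move=> c0 zc; rewrite [leLHS]/Num.norm /= mx_normrE; apply/bigmax_leP; split=> //.
by move=> [i j] _ /=; rewrite (ord1 j).
Qed.

Lemma norm_mulmx_le (A : 'M[R]_2) :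
  exists2 c : R, 0 < c & forall h, `|A *m h| <= c * `|h|.
Proof.
exists (1 + \sum_i \sum_j `|A i j|) => [|h].
  by apply: ltr_wpDr => //; apply: sumr_ge0 => i _; exact: sumr_ge0.
have s0 i : 0 <= \sum_j `|A i j| by exact: sumr_ge0.
apply: norm_le => [|i].
  by rewrite mulr_ge0 // addr_ge0 // sumr_ge0.
rewrite mxE (le_trans (ler_norm_sum _ _ _)) //.
apply: (@le_trans _ _ ((\sum_j `|A i j|) * `|h|)).
  by rewrite mulr_suml ler_sum // => j _; rewrite normrM ler_wpM2l // norm_coord.
rewrite ler_wpM2r // (le_trans _ (ler_wpDl ler01 (lexx _))) //.
by rewrite [leRHS](bigD1 i) //= lerDl sumr_ge0.
Qed.

Lemma follows_open S z : follows p S z ->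
  (forall i, (i < size S)%N -> xcoord (pieces p (take i S) z) <> 0) ->
  exists2 e : R, 0 < e & forall h, `|h| < e -> follows p S (z + h).
Proof.
elim: S z => [|J S IH] z /=; first by exists 1.
move=> [sJ fS] nz.
have [i iS|e e0 He] := IH _ fS; first exact: (nz i.+1).
have [c c0 Hc] := norm_mulmx_le (mat p J).
have x0 : 0 < `|xcoord z| by rewrite normr_gt0; apply/eqP; exact: (nz 0%N).
exists (Num.min `|xcoord z| (e / c)) => [|h]; first by rewrite lt_min x0 divr_gt0.
rewrite lt_min => /andP[hx he]; split.
  have := norm_coord h ord0; move: sJ hx.
  rewrite /side /xcoord mxE; case: J {IH fS nz Hc He} => /= sJ.
    by rewrite ler0_norm ?ler_norml; lra.
  by rewrite ger0_norm ?ler_norml; lra.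
rewrite piece_add; apply: He; apply: le_lt_trans (Hc h) _.
by rewrite mulrC -ltr_pdivlMr.
Qed.

(** Near a cycle off the switching manifold, one turn is the affine map of its
    word, so the deviations from the cycle are given by powers of its matrix. *)
Lemma stable_bounded S z : pieces p S z = z -> follows p S z ->
  (forall i, (i < size S)%N -> xcoord (pieces p (take i S) z) <> 0) ->
  lyapunov_stable f z ->
  exists c : R, forall j i k, `|(word_mx p S ^+ j) i k| <= c.
Proof.
move=> fz fS nz st; have [e e0 He] := follows_open fS nz.
have [d d0 Hd] := st e e0; exists (2 * e / d) => j i k.
have fixz m : iter (m * size S) f z = z.
  by elim: m => // m IH; rewrite mulSn iterD IH (iter_follows fS).
have lin m h : `|h| < d ->
    iter (m * size S) f (z + h) = z + word_mx p S ^+ m *m h.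
  move=> hd; elim: m => [|m IH]; first by rewrite expr0 mul1mx.
  have hm : `|word_mx p S ^+ m *m h| < e.
    have := Hd (z + h) _ (m * size S)%N; rewrite IH fixz addrAC subrr add0r.
    by rewrite addrAC subrr add0r => /(_ hd).
  rewrite mulSn iterD IH (iter_follows (He _ hm)) pieces_add fz mulmxA.
  by rewrite exprS.
have hd : `|(d / 2) *: (delta_mx k ord0 : 'cV[R]_2)| < d.
  apply: (@le_lt_trans _ _ (d / 2)); last by lra.
  apply: norm_le => [|l]; first by lra.
  rewrite !mxE normrM ger0_norm; last by lra.
  by case: (_ && _); rewrite ?normr1 ?normr0; lra.
have := Hd (z + (d / 2) *: delta_mx k ord0) _ (j * size S)%N.
rewrite lin // fixz addrAC subrr add0r addrAC subrr add0r => /(_ hd).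
move=> /(le_lt_trans (norm_coord _ i)).
rewrite -scalemxAr -colE !mxE normrM (ger0_norm (_ : 0 <= d / 2)); last by lra.
by rewrite ler_pdivlMr // => H; lra.
Qed.

End Cycles.

Section Matrices.
Context {R : realType}.
Implicit Types M : 'M[R]_2.

Let i1 : 'I_2 := lift ord0 ord0.

Lemma trace2 M : \tr M = M ord0 ord0 + M i1 i1.
Proof. by rewrite /mxtrace !big_ord_recl big_ord0 addr0. Qed.

Lemma det2 M : \det M = M ord0 ord0 * M i1 i1 - M ord0 i1 * M i1 ord0.
Proof.
rewrite (expand_det_row _ ord0) !big_ord_recl big_ord0 addr0 /cofactor !det_mx11.
rewrite !mxE /= -/i1 expr0 mul1r expr1.
have -> : lift i1 ord0 = ord0 :> 'I_2 by apply/val_inj.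
by rewrite mulN1r mulrN.
Qed.

Lemma trace_recurrence M j :
  \tr (M ^+ j.+2) = \tr M * \tr (M ^+ j.+1) - \det M * \tr (M ^+ j).
Proof.
have -> : M ^+ j.+2 = \tr M *: M ^+ j.+1 - \det M *: M ^+ j.
  have MM : M * M = \tr M *: M - \det M *: 1.
    apply/matrixP => a b; rewrite trace2 det2 !mxE !big_ord_recl big_ord0 -/i1.
    case: (unliftP ord0 a) => [a'|] ->; case: (unliftP ord0 b) => [b'|] ->;
    rewrite ?(ord1 a') ?(ord1 b') -/i1 ?eqxx /=; ring.
  by rewrite !exprS mulrA MM mulrBl -!scalerAl mul1r.
by rewrite linearB /= !mxtraceZ.
Qed.

(** The powers grow if the trace exceeds [2], the determinant being at most [1];
    the last inequality is the trace bound for the square of [M]. *)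
Lemma bounded_powers M (c : R) : (forall j i k, `|(M ^+ j) i k| <= c) ->
  [/\ `|\tr M| <= 2, `|\det M| <= 1 & (\tr M) ^+ 2 - 2 * \det M <= 2].
Proof.
have pow_bounded (a b : R) : (forall j, `|a| ^+ j <= b) -> `|a| <= 1.
  move=> ab; rewrite leNgt; apply/negP => a1.
  have lim0 : (fun k => `|a|^-1 ^+ k) @ \oo --> (0 : R).
    have a0 : 0 < `|a| by exact: lt_trans a1.
    by apply: cvg_expr; rewrite gtr0_norm ?invr_gt0 // invf_lt1.
  have b0 : 0 < b by apply: lt_le_trans (ab 0%N); rewrite expr0.
  have [K _ /(_ K (leqnn K))] := cvgr_lt _ lim0 b^-1 (ltac:(by rewrite invr_gt0)).
  rewrite exprVn ltf_pV2 ?posrE // ?exprn_gt0 ?(lt_trans ltr01 a1) //.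
  by rewrite ltNge ab.
have det_le M' b : (forall j i k, `|(M' ^+ j) i k| <= b) -> `|\det M'| <= 1.
  move=> Mb; apply: (pow_bounded _ (2 * b ^+ 2)) => j.
  have -> : `|\det M'| ^+ j = `|\det (M' ^+ j)|.
    elim: j => [|j IH]; first by rewrite !expr0 det1 normr1.
    by rewrite !exprS IH det_mulmx normrM.
  rewrite det2 (le_trans (ler_normB _ _)) //.
  by rewrite mulr2n mulrDl !mul1r !normrM lerD // expr2 ler_pM.
have tr_le M' b : (forall j i k, `|(M' ^+ j) i k| <= b) -> `|\tr M'| <= 2.
  move=> Mb; have dM := det_le _ _ Mb; rewrite leNgt; apply/negP => t2.
  pose t j := `|\tr (M' ^+ j)|.
  have grow j : 2 <= t j /\ `|\tr M'| / 2 * t j <= t j.+1.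
    elim: j => [|j [tj Hj]].
      by rewrite /t expr0 expr1 mxtrace1 normr_nat; split=> //; lra.
    have tj1 : t j <= t j.+1.
      by apply: le_trans Hj; rewrite ler_peMl ?(le_trans _ tj) //; lra.
    have tj2 : t j.+1 <= `|\tr M'| / 2 * t j.+1.
      by rewrite ler_peMl ?(le_trans _ (le_trans tj tj1)) //; lra.
    have dt : `|\det M'| * t j <= t j by rewrite ler_piMl ?(le_trans _ tj).
    split; first exact: le_trans tj1.
    have := lerB_normD (\tr M' * \tr (M' ^+ j.+1)) (- (\det M' * \tr (M' ^+ j))).
    rewrite -trace_recurrence normrN !normrM -!/(t _); lra.
  have geo j : (`|\tr M'| / 2) ^+ j <= t j.
    elim: j => [|j IH]; first by rewrite expr0; have [] := grow 0%N; lra.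
    by rewrite exprS (le_trans _ (grow j).2) // ler_wpM2l //; lra.
  have : `|(`|\tr M'| / 2)| <= 1.
    apply: (pow_bounded _ (2 * b)) => j; rewrite ger0_norm; last by lra.
    rewrite (le_trans (geo j)) // /t trace2 (le_trans (ler_normD _ _)) //.
    by rewrite mulr2n mulrDl !mul1r lerD.
  by rewrite ger0_norm; lra.
move=> Mc; split; [exact: tr_le Mc|exact: det_le Mc|].
have /tr_le : forall j i k, `|((M ^+ 2) ^+ j) i k| <= c by move=> j; rewrite -exprM.
by rewrite trace_recurrence expr1 expr0 mxtrace1 -expr2 ler_norml => /andP[_]; lra.
Qed.

End Matrices.

(** * Eigen-coordinates *)

Section Kernels.
Context {R : realType} (p : bcnf R).
Implicit Types (M : 'M[R]_2) (z h : 'cV[R]_2) (S : word).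

Let i1 : 'I_2 := lift ord0 ord0.

Lemma singular_kernel M : \det M = 0 -> exists2 h : 'cV[R]_2, h <> 0 & M *m h = 0.
Proof.
rewrite -det_tr => /eqP/det0P[v /eqP v0 Mv]; exists v^T.
  by move=> vT; apply: v0; rewrite -[v]trmxK vT trmx0.
by rewrite -[M]trmxK -trmx_mul Mv trmx0.
Qed.

(** If [h] is in the kernel of a piece, then [h] or [- h] is on the side of that
    piece and has the same image as the origin. *)
Lemma bcmap_inj_det S : injective (bcmap p) -> \det (word_mx p S) <> 0.
Proof.
move=> f_inj.
have matN J : \det (mat p J) != 0.
  apply/eqP => /singular_kernel[h h0 Mh].
  have side0 : side J (0 : 'cV[R]_2) by rewrite /side /xcoord mxE mulr0.
  have noside k : k *: h <> 0 -> ~ side J (k *: h).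
    move=> kh0 sh; apply: kh0; apply: f_inj.
    rewrite (bcmap_side _ sh) (bcmap_side _ side0) -[k *: h]add0r piece_add.
    by rewrite -scalemxAr Mh scaler0 addr0.
  have s1 : ~ side J (1 *: h) by apply: noside; rewrite scale1r.
  have s2 : ~ side J (-1 *: h).
    by apply: noside; rewrite scaleN1r => /eqP; rewrite oppr_eq0 => /eqP.
  move: s1 s2; rewrite /side /xcoord !mxE => s1 s2.
  have [a|b] := lerP 0 (symb_sign J * h ord0 ord0); first by apply: s1; rewrite mul1r.
  by apply: s2; rewrite mulN1r mulrN oppr_ge0 ltW.
apply/eqP; elim: S => [|J S IH]; first by rewrite det1 oner_eq0.
by rewrite word_mx_cons det_mulmx mulf_neq0.
Qed.

(** The left-hand side is the characteristic polynomial of the matrix at [1]. *)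
Lemma unique_fixed_det S z : pieces p S z = z ->
  (forall z', pieces p S z' = z' -> z' = z) ->
  1 - \tr (word_mx p S) + \det (word_mx p S) <> 0.
Proof.
move=> fz uz d0.
have /singular_kernel[h h0] : \det (1%:M - word_mx p S) = 0.
  by move: d0; rewrite !det2 trace2 !mxE /= => <-; ring.
rewrite mulmxBl mul1mx => /eqP; rewrite subr_eq0 => /eqP Mh; apply: h0.
by have /eqP := uz (z + h) (ltac:(by rewrite pieces_add fz -Mh));
   rewrite -subr_eq0 addrAC subrr add0r => /eqP.
Qed.

Definition ccvg (z : nat -> 'cV[R]_2) (l : 'cV[R]_2) :=
  forall i, (fun k => z k i ord0) @ \oo --> l i ord0.

Lemma ccvg_piece J (z : nat -> 'cV[R]_2) l :
  ccvg z l -> ccvg (fun k => piece p J (z k)) (piece p J l).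
Proof.
move=> zl i.
have pE y : piece p J y i ord0 = mat p J i ord0 * y ord0 ord0 +
    mat p J i i1 * y i1 ord0 + mu p * (delta_mx ord0 ord0 : 'cV[R]_2) i ord0.
  rewrite /piece [LHS]mxE [X in X + _]mxE [X in _ + X]mxE.
  by rewrite !big_ord_recl big_ord0 addr0.
rewrite pE; under eq_fun do rewrite pE.
apply: cvgD; last exact: cvg_cst.
by apply: cvgD; apply: cvgM; (exact: cvg_cst || exact: zl).
Qed.

(** Closedness of the half-planes, passed through the continuous pieces. *)
Lemma follows_limit (G : set nat) S (z : nat -> 'cV[R]_2) l : infinite_set G -> ccvg z l ->
  (\forall k \near \oo, G k -> follows p S (z k)) -> follows p S l.
Proof.
move=> Ginf; elim: S z l => //= J S IH z l zl [K _ Kz]; split; last first.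
  apply: (IH (fun k => piece p J (z k))); first exact: ccvg_piece.
  by exists K => // k Kk Gk; have [] := Kz k Kk Gk.
have [//|neg] := side_total J l.
have lim : (fun k => symb_sign J * z k ord0 ord0) @ \oo --> symb_sign J * l ord0 ord0.
  by apply: cvgM; [exact: cvg_cst|exact: zl].
have [K' _ K'z] := cvgr_lt _ lim 0 neg.
have nearK : \forall k \near \oo, (maxn K K' <= k)%N by exists (maxn K K').
have [k Gk] := infinite_frequently Ginf nearK.
rewrite geq_max => /andP[Kk K'k].
have [+ _] := Kz k Kk Gk; rewrite /side leNgt => /negP[].
exact: K'z.
Qed.

End Kernels.

Section Eigen.
Context {R : realType}.
Implicit Types (M : 'M[R]_2).
Context (zeta1 zeta2 : 'cV[R]_2) (l1 l2 : R) (M0 : 'M[R]_2).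
Context (E1 : eigenvector M0 l1 zeta1) (E2 : eigenvector M0 l2 zeta2) (l12 : l1 < l2).

Let i1 : 'I_2 := lift ord0 ord0.

Local Notation Q := (row_mx zeta1 zeta2 : 'M[R]_2).

Lemma eigen_free u v : u *: zeta1 + v *: zeta2 = 0 -> u = 0 /\ v = 0.
Proof.
move=> uv0; have [z1 M1] := E1; have [z2 M2] := E2.
have : M0 *m (u *: zeta1 + v *: zeta2) = 0 by rewrite uv0 mulmx0.
rewrite mulmxDr -!scalemxAr M1 M2 => Muv0.
have : (u *: (l1 *: zeta1) + v *: (l2 *: zeta2)) - l1 *: (u *: zeta1 + v *: zeta2) = 0.
  by rewrite Muv0 uv0 scaler0 subr0.
rewrite scalerDr !scalerA (mulrC u) opprD addrACA subrr add0r -scalerBl.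
move=> /eqP; rewrite scaler_eq0 (mulrC v) -mulrBl mulf_eq0 subr_eq0 (gt_eqF l12) /=.
case/orP=> /eqP // v0; split=> //; move: uv0; rewrite v0 scale0r addr0.
by move/eqP; rewrite scaler_eq0 => /orP[] /eqP.
Qed.

Lemma row_mx0 (A B : 'cV[R]_2) i : (row_mx A B : 'M[R]_2) i ord0 = A i ord0.
Proof. by rewrite -(row_mxEl A B); congr (row_mx _ _ _ _); apply/val_inj. Qed.

Lemma row_mx1 (A B : 'cV[R]_2) i : (row_mx A B : 'M[R]_2) i i1 = B i ord0.
Proof. by rewrite -(row_mxEr A B); congr (row_mx _ _ _ _); apply/val_inj. Qed.

Lemma col_comb h : Q *m h = h ord0 ord0 *: zeta1 + h i1 ord0 *: zeta2.
Proof.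
apply/matrixP => i j; rewrite (ord1 j) !mxE !big_ord_recl big_ord0 addr0 -/i1.
rewrite row_mx0 row_mx1.
by rewrite mulrC (mulrC (zeta2 _ _)).
Qed.

Lemma eigen_unit : Q \in unitmx.
Proof.
rewrite unitmxE unitfE; apply/eqP => /singular_kernel[h h0].
rewrite col_comb => /eigen_free[h00 h10]; apply: h0; apply/matrixP => i j.
rewrite (ord1 j) mxE; case: (unliftP ord0 i) => [i'|] -> //.
by rewrite (ord1 i').
Qed.

Lemma eigen_coord z : exists u v, z = u *: zeta1 + v *: zeta2.
Proof.
by exists ((invmx Q *m z) ord0 ord0), ((invmx Q *m z) i1 ord0);
   rewrite -col_comb mulKVmx // eigen_unit.
Qed.

Lemma eigen_trace_det M a b c d :
  M *m zeta1 = a *: zeta1 + c *: zeta2 -> M *m zeta2 = b *: zeta1 + d *: zeta2 ->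
  \tr M = a + d /\ \det M = a * d - b * c.
Proof.
move=> M1 M2.
pose T : 'M[R]_2 := \matrix_(i, j)
  if i == ord0 then (if j == ord0 then a else b) else (if j == ord0 then c else d).
have MQ : M *m Q = Q *m T.
  apply/matrixP => i j; case: (unliftP ord0 j) => [j'|] ->.
    rewrite (ord1 j') -/i1.
    have -> : (M *m Q) i i1 = (M *m zeta2) i ord0.
      by rewrite !mxE; apply: eq_bigr => k _; rewrite row_mx1.
    have -> : (Q *m T) i i1 = (Q *m col i1 T) i ord0.
      by rewrite !mxE; apply: eq_bigr => k _; rewrite !mxE.
    by rewrite M2 col_comb !mxE /=.
  have -> : (M *m Q) i ord0 = (M *m zeta1) i ord0.
    by rewrite !mxE; apply: eq_bigr => k _; rewrite row_mx0.
  have -> : (Q *m T) i ord0 = (Q *m col ord0 T) i ord0.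
    by rewrite !mxE; apply: eq_bigr => k _; rewrite !mxE.
  by rewrite M1 col_comb !mxE /=.
have -> : M = Q *m T *m invmx Q by rewrite -MQ mulmxK // eigen_unit.
rewrite mxtrace_mulC mulKmx ?eigen_unit // trace2 !mxE /=; split=> //.
rewrite !det_mulmx det_inv mulrAC mulfV ?mul1r; last by rewrite -unitfE -unitmxE eigen_unit.
by rewrite det2 !mxE /=.
Qed.

End Eigen.

Lemma word_powD (W : word) j k : word_pow W (j + k) = word_pow W j ++ word_pow W k.
Proof. by rewrite /word_pow nseqD flatten_cat. Qed.

Lemma word_powS (W : word) k : word_pow W k.+1 = W ++ word_pow W k.
Proof. by []. Qed.

(** * The limiting homoclinic orbit *)

Section Limit.
Context {R : realType} (p : bcnf R) (X Y : word) (l1 l2 : R) (zeta1 zeta2 : 'cV[R]_2).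
Context (X_prim : primitive X) (Y_nonempty : Y <> [::]).
Context (X0_neq_Y0 : symb X 0 <> symb Y 0).
Context (cycles : infinite_set
  [set k : nat | (1 <= k)%N /\ has_good_cycle p (XkY X Y k)]).
Context (l1_bounds : 0 <= l1 < 1) (l2_bound : 1 < l2).
Context (E1 : eigenvector (word_mx p X) l1 zeta1).
Context (E2 : eigenvector (word_mx p X) l2 zeta2).
Context (v_axis : ~ parallel_to_switching zeta2).
Context (f_inj : injective (bcmap p)).

Local Notation n := (size X).
Local Notation w0 := (cycle_pt p X 0).

Let l12 : l1 < l2.
Proof. by have /andP[_ h] := l1_bounds; exact: lt_trans h l2_bound. Qed.

Lemma eigenvalue_gt0 : 0 < l1.
Proof.
have [_ M1] := E1; have [_ M2] := E2.
have M1' : word_mx p X *m zeta1 = l1 *: zeta1 + 0 *: zeta2 by rewrite scale0r addr0.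
have M2' : word_mx p X *m zeta2 = 0 *: zeta1 + l2 *: zeta2 by rewrite scale0r add0r.
have [_ dE] := eigen_trace_det E1 E2 l12 M1' M2'.
have [l10 _] := andP l1_bounds; rewrite lt_neqAle l10 andbT; apply/eqP => l1E.
by apply: (@bcmap_inj_det _ p X f_inj); rewrite dE -l1E !mul0r subr0.
Qed.

Lemma saddle_fixed : pieces p X w0 = w0.
Proof.
have [_ M1] := E1; have [_ M2] := E2.
have [a [b ab]] := eigen_coord E1 E2 l12 (pieces p X 0).
have n1 : 1 - l1 != 0 by have /andP[_ h] := l1_bounds; rewrite subr_eq0 gt_eqF.
have n2 : 1 - l2 != 0 by rewrite subr_eq0 lt_eqF.
pose z := (a / (1 - l1)) *: zeta1 + (b / (1 - l2)) *: zeta2.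
have fz : pieces p X z = z.
  rewrite -[z in LHS]add0r pieces_add ab mulmxDr -!scalemxAr M1 M2 !scalerA.
  by rewrite addrACA -!scalerDl; congr (_ *: _ + _ *: _); field.
rewrite (cycle_pt_fixed (z := z)) ?take0 //; first by case: X_prim.
move=> z' fz'; have [u [v uv]] := eigen_coord E1 E2 l12 (z' - z).
have : (u - l1 * u) *: zeta1 + (v - l2 * v) *: zeta2 = 0.
  have : z' - z = word_mx p X *m (z' - z).
    have zz : z + (z' - z) = z' by rewrite addrC subrK.
    by apply: (addrI (pieces p X z)); rewrite -pieces_add zz fz' fz.
  rewrite uv mulmxDr -!scalemxAr M1 M2 !scalerA => /eqP; rewrite -subr_eq0.
  by rewrite opprD addrACA -!scalerBl (mulrC u) (mulrC v) => /eqP.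
case/(eigen_free E1 E2 l12) => /eqP u0 /eqP v0; move: u0 v0.
rewrite -{1}[u]mul1r -{1}[v]mul1r -!mulrBl !mulf_eq0 (negPf n1) (negPf n2) /=.
move=> /eqP u0 /eqP v0; move: uv; rewrite u0 v0 !scale0r addr0 => /eqP.
by rewrite subr_eq0 => /eqP.
Qed.

Definition pl (u v : R) : 'cV[R]_2 := w0 + (u *: zeta1 + v *: zeta2).

Lemma pl_inj u v u' v' : pl u v = pl u' v' -> u = u' /\ v = v'.
Proof.
move=> /addrI/eqP; rewrite -subr_eq0 opprD addrACA -!scalerBl => /eqP.
by case/(eigen_free E1 E2 l12) => /eqP + /eqP; rewrite !subr_eq0 => /eqP -> /eqP ->.
Qed.

Lemma pl_surj z : exists u v, z = pl u v.
Proof.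
have [u [v uv]] := eigen_coord E1 E2 l12 (z - w0).
by exists u, v; rewrite /pl -uv addrC subrK.
Qed.

Lemma pl_unstable v s : w0 + s *: (v *: zeta2) = pl 0 (s * v).
Proof. by rewrite /pl scale0r add0r scalerA. Qed.

Lemma pl_stable u s : w0 + s *: (u *: zeta1) = pl (s * u) 0.
Proof. by rewrite /pl scale0r addr0 scalerA. Qed.

Lemma X_pl u v : pieces p X (pl u v) = pl (l1 * u) (l2 * v).
Proof.
have [_ M1] := E1; have [_ M2] := E2.
rewrite /pl pieces_add saddle_fixed mulmxDr -!scalemxAr M1 M2 !scalerA.
by rewrite (mulrC u) (mulrC v).
Qed.

Lemma Xk_pl k u v : pieces p (word_pow X k) (pl u v) = pl (l1 ^+ k * u) (l2 ^+ k * v).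
Proof.
elim: k u v => [|k IH] u v; first by rewrite !expr0 !mul1r.
by rewrite word_powS pieces_cat X_pl IH !mulrA -!exprSr.
Qed.

Lemma Xk_eigen k : word_mx p (word_pow X k) *m zeta1 = l1 ^+ k *: zeta1 /\
  word_mx p (word_pow X k) *m zeta2 = l2 ^+ k *: zeta2.
Proof.
have [_ M1] := E1; have [_ M2] := E2.
elim: k => [|k [IH1 IH2]]; first by rewrite /word_mx /= !mul1mx !expr0 !scale1r.
rewrite word_powS word_mx_cat -!mulmxA M1 M2 -!scalemxAr.
by rewrite IH1 IH2 !scalerA -!exprS.
Qed.

Lemma xcoord_pl u v :
  xcoord (pl u v) = xcoord w0 + (u * xcoord zeta1 + v * xcoord zeta2).
Proof. by rewrite /xcoord !mxE. Qed.

Lemma ccvg_pl (u v : nat -> R) (a b : R) : u @ \oo --> a -> v @ \oo --> b ->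
  ccvg (fun k => pl (u k) (v k)) (pl a b).
Proof.
move=> ua vb i; under eq_fun do rewrite !mxE; rewrite !mxE.
apply: cvgD; first exact: cvg_cst.
by apply: cvgD; (apply: cvgM; last exact: cvg_cst).
Qed.

Lemma lim_pl (F : nat -> 'cV[R]_2) (u v : nat -> R) (a b : R) :
  u @ \oo --> a -> v @ \oo --> b ->
  (\forall k \near \oo, F k = pl (u k) (v k)) -> lim (F @ \oo) = pl a b.
Proof.
move=> ua vb FE; apply: cvg_lim; first exact: norm_hausdorff.
have : (fun k => pl (u k) (v k)) @ \oo --> pl a b.
  apply: cvgD; first exact: cvg_cst.
  by apply: cvgD; exact: cvgZr_tmp.
by apply: cvg_trans; apply: near_eq_cvg; apply: filterS FE => k ->.
Qed.

Lemma side_head W z : W <> [::] -> follows p W z -> side (symb W 0) z.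
Proof. by case: W => //= J W _ []; rewrite /symb mod0n. Qed.

Lemma take_pow j k : (j <= k)%N -> take (j * n) (XkY X Y k) = word_pow X j.
Proof.
move=> jk; rewrite /XkY -(subnKC jk) word_powD -catA take_size_cat //.
by rewrite size_word_pow.
Qed.

(** With the numbers at hand, the cycle of [X^k Y] exists and is unique for all
    large [k] and is known explicitly, which gives the limits; the itineraries
    are inherited from the infinitely many admissible cycles. *)
Lemma homoclinic_limit : exists bv cv, [/\ homoclinic p X Y w0 bv cv l1,
  hom_a p X Y = w0 + l1 *: bv, hom_b p X Y = w0 + bv,
  hom_c p X Y = w0 + cv & hom_d p X Y = w0 + l1 *: cv].
Proof.
have l10 := eigenvalue_gt0; have [_ l11] := andP l1_bounds.
have l20 : 0 < l2 by exact: lt_trans l2_bound.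
have X0 : X <> [::] by case: X_prim.
have YE S : S ++ Y <> [::] by case: S => //; case: Y Y_nonempty.
have S0 k : XkY X Y k <> [::] by exact: YE.
have [s1 [s2 sE]] := pl_surj (pieces p Y w0).
have [g11 [g21 gE1]] := eigen_coord E1 E2 l12 (word_mx p Y *m zeta1).
have [g12 [g22 gE2]] := eigen_coord E1 E2 l12 (word_mx p Y *m zeta2).
have Y_pl u v : pieces p Y (pl u v) =
    pl (g11 * u + g12 * v + s1) (g21 * u + g22 * v + s2).
  rewrite [pl u v]/pl pieces_add sE mulmxDr -!scalemxAr gE1 gE2 /pl -addrA.
  congr (_ + _); apply/matrixP => i j; rewrite !mxE; ring.
have S_pl k u v : pieces p (XkY X Y k) (pl u v) =
    pl (g11 * (l1 ^+ k * u) + g12 * (l2 ^+ k * v) + s1)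
       (g21 * (l1 ^+ k * u) + g22 * (l2 ^+ k * v) + s2).
  by rewrite /XkY pieces_cat Xk_pl Y_pl.
pose G := [set k : nat | (1 <= k)%N /\ has_good_cycle p (XkY X Y k)].
have dg0 : g11 * g22 - g12 * g21 <> 0.
  by have [_ <-] := eigen_trace_det E1 E2 l12 gE1 gE2; exact: bcmap_inj_det.
have S_trdet k : \tr (word_mx p (XkY X Y k)) = g11 * l1 ^+ k + g22 * l2 ^+ k /\
    \det (word_mx p (XkY X Y k)) = (l1 * l2) ^+ k * (g11 * g22 - g12 * g21).
  have [k1 k2] := Xk_eigen k.
  have M1 : word_mx p (XkY X Y k) *m zeta1 =
      (g11 * l1 ^+ k) *: zeta1 + (g21 * l1 ^+ k) *: zeta2.
    rewrite word_mx_cat -mulmxA k1 -scalemxAr gE1 scalerDr !scalerA.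
    by rewrite (mulrC g11) (mulrC g21).
  have M2 : word_mx p (XkY X Y k) *m zeta2 =
      (g12 * l2 ^+ k) *: zeta1 + (g22 * l2 ^+ k) *: zeta2.
    rewrite word_mx_cat -mulmxA k2 -scalemxAr gE2 scalerDr !scalerA.
    by rewrite (mulrC g12) (mulrC g22).
  have [-> ->] := eigen_trace_det E1 E2 l12 M1 M2; split=> //.
  by rewrite exprMn; ring.
have pow1 (l : R) k : l != 0 -> (1 <= k)%N -> l ^+ k.-1 = l ^+ k / l.
  by move=> l0; case: k => // k _; rewrite exprS mulrC mulKf.
have [] := @homoclinic_numbers R G l1 l2 g11 g12 g21 g22 s1 s2 (xcoord w0)
  (xcoord zeta1) (xcoord zeta2) cycles _ l2_bound v_axis dg0.
- by rewrite l10.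
- move=> k [k1 /(good_cycle_point (S0 k))[z [fz uz fol nz st]]].
  have [trE detE] := S_trdet k.
  have [c Hc] := stable_bounded fz fol nz st.
  have [tr2 dt1 td] := bounded_powers Hc.
  have un := unique_fixed_det fz uz.
  rewrite trE detE in tr2 dt1 td un; split=> //.
  have [u [v zE]] := pl_surj z; rewrite {}zE in fz uz fol nz st.
  exists u, v; have [uE vE] := pl_inj (esym (etrans (esym (S_pl k u v)) fz)).
  have /follows_cat[fX] := fol; rewrite Xk_pl => fY.
  have fX' : follows p X (pl (l1 ^+ k / l1 * u) (l2 ^+ k / l2 * v)).
    rewrite -!pow1 ?gt_eqF // -Xk_pl.
    have kE : word_pow X k = word_pow X k.-1 ++ X.
      by rewrite -[in LHS](prednK k1) -addn1 word_powD word_powS cats0.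
    by move: fX; rewrite kE => /follows_cat[].
  have /= sX := side_head X0 fX'; have /= sY := side_head Y_nonempty fY.
  have kn : (k * n < size (XkY X Y k))%N.
    by rewrite size_cat size_word_pow -[ltnLHS]addn0 ltn_add2l; case: Y Y_nonempty.
  have xb0 := nz _ kn; rewrite take_pow // Xk_pl in xb0.
  rewrite !xcoord_pl !addrA in xb0 *; split=> //.
  move: sX sY; rewrite /side !xcoord_pl !addrA.
  by case: (symb X 0) (symb Y 0) X0_neq_Y0 => -[] //= _; nra.
move=> g220 ll g1 s20 s10; rewrite {}g220 {}s20 in gE2 Y_pl S_pl S_trdet dg0.
have g210 : g21 != 0 by apply: contra_notN dg0 => /eqP ->; rewrite !mulr0 subr0.
pose q k : R := l1 ^+ k.
pose D k := 1 - g11 * q k - g12 * g21.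
pose u k := s1 / D k.
pose ga := s1 / (1 - g12 * g21).
have ga0 : ga != 0.
  rewrite mulf_neq0 ?invr_eq0 //; first exact/eqP.
  by rewrite subr_eq0 eq_sym; exact/eqP.
have q0 : q @ \oo --> (0 : R) by apply: cvg_expr; rewrite gtr0_norm.
have DL : D @ \oo --> 1 - g12 * g21.
  rewrite -[X in _ --> X - _]subr0 -(mulr0 g11).
  apply: cvgB; last exact: cvg_cst.
  by apply: cvgB; [exact: cvg_cst|apply: cvgM => //; exact: cvg_cst].
have DL0 : 1 - g12 * g21 != 0 by rewrite subr_eq0 eq_sym; exact/eqP.
have uL : u @ \oo --> ga by apply: cvgM; [exact: cvg_cst|exact: cvgV].
have nearD : \forall k \near \oo, D k != 0.
  have nD : (fun k => `|D k|) @ \oo --> `|1 - g12 * g21| by apply: cvg_norm.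
  have pos : 0 < `|1 - g12 * g21| by rewrite normr_gt0.
  have npos : \forall k \near \oo, 0 < `|D k| by exact: (cvgr_gt _ nD 0 pos).
  by apply: filterS npos => k; rewrite normr_gt0.
have l2q k : l2 ^+ k * q k = 1 by rewrite /q -exprMn mulrC ll expr1n.
(* the base point of the cycle of [X^k Y] is [pl (u k) (v k)] *)
pose v k := g21 * (q k * u k).
have l2v k : l2 ^+ k * v k = g21 * u k.
  by rewrite /v mulrCA (mulrA (l2 ^+ k)) l2q mul1r.
have fixS k : D k != 0 -> pieces p (XkY X Y k) (pl (u k) (v k)) = pl (u k) (v k).
  move=> Dk; rewrite S_pl l2v mul0r !addr0 -/(q k); congr (pl _ _).
  have : u k * D k = s1 by rewrite divfK.
  by rewrite {1}/D; lra.
have uniqS k z : D k != 0 -> pieces p (XkY X Y k) z = z -> z = pl (u k) (v k).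
  move=> Dk; have [a [b ->]] := pl_surj z.
  rewrite S_pl mul0r !addr0 -/(q k) => /pl_inj[aE bE].
  have aD : a * D k = s1.
    move: aE; rewrite -bE (mulrCA (l2 ^+ k)) (mulrA (l2 ^+ k)) l2q mul1r /D; lra.
  by rewrite -bE; have -> : a = u k by rewrite /u -aD mulfK.
have cycle_at j k : D k != 0 -> (j <= k)%N ->
    cycle_pt p (XkY X Y k) (j * n)%N = pl (l1 ^+ j * u k) (l2 ^+ j * v k).
  move=> Dk jk; rewrite -Xk_pl -(take_pow jk); apply: cycle_pt_fixed => //.
  - exact: fixS.
  - by move=> z; exact: uniqS.
  - by rewrite size_cat size_word_pow (leq_trans (leq_mul jk (leqnn _))) // leq_addr.
have quL : (fun k => q k * u k) @ \oo --> (0 : R).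
  by rewrite -(mul0r ga); exact: cvgM.
have vL : v @ \oo --> (0 : R).
  by rewrite -(mulr0 g21); apply: cvgM => //; exact: cvg_cst.
have near1 : \forall k \near \oo, (1 <= k)%N /\ D k != 0.
  by apply: filterS2 nearD (nbhs_infty_gt 0) => k.
pose be := g21 * ga.
have bL : (fun k => g21 * u k) @ \oo --> be by apply: cvgM => //; exact: cvg_cst.
have aL l : (fun k => q k * u k / l1 ^+ l) @ \oo --> (0 : R).
  by rewrite -(mul0r (l1 ^+ l)^-1); apply: cvgM => //; exact: cvg_cst.
have abL l : (fun k => l1 ^+ l * (g21 * u k)) @ \oo --> l1 ^+ l * be.
  by apply: cvgM => //; exact: cvg_cst.
(* coordinates of the cycle [l] turns before the end of its passage *)
have back l k : (l <= k)%N -> l1 ^+ (k - l) * u k = q k * u k / l1 ^+ l /\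
    l2 ^+ (k - l) * v k = l1 ^+ l * (g21 * u k).
  move=> lk; have lN : l1 ^+ l != 0 by rewrite expf_neq0 // gt_eqF.
  have kE : q k = l1 ^+ (k - l) * l1 ^+ l by rewrite -exprD subnK.
  split; first by rewrite kE mulrAC mulfK.
  have l2E : l2 ^+ k * l1 ^+ l = l2 ^+ (k - l).
    by rewrite -{1}(subnK lk) exprD -mulrA -exprMn (mulrC l2) ll expr1n mulr1.
  by rewrite -l2E mulrAC l2v mulrC.
have good_follows k : D k != 0 -> G k -> follows p (XkY X Y k) (pl (u k) (v k)).
  move=> Dk [k1 /(good_cycle_point (S0 k))[z [fz _ fol _ _]]].
  by rewrite -(uniqS k z Dk fz).
have back_follows l : (0 < l)%N -> follows p (word_pow X l ++ Y) (pl 0 (l1 ^+ l * be)).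
  move=> l0; apply: (follows_limit cycles (ccvg_pl (aL l) (abL l))).
  apply: filterS2 nearD (nbhs_infty_ge l) => k Dk lk /(good_follows k Dk).
  have [<- <-] := back l k lk.
  by rewrite /XkY -{1}(subnK lk) word_powD -catA => /follows_cat[_]; rewrite Xk_pl.
have goodX k : D k != 0 -> G k -> follows p X (pl (u k) (v k)).
  move=> Dk Gk; have := good_follows k Dk Gk; have [k1 _] := Gk.
  by rewrite /XkY -(prednK k1) word_powS -catA => /follows_cat[].
exists (be *: zeta2), (ga *: zeta1).
have l1N : l1 != 0 by rewrite gt_eqF.
have b1 : w0 + be *: zeta2 = pl 0 be by rewrite -[be *: _]scale1r pl_unstable mul1r.
have c1 : w0 + ga *: zeta1 = pl ga 0 by rewrite -[ga *: _]scale1r pl_stable mul1r.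
have l2E : l1^-1 = l2 by rewrite -[LHS]mulr1 -ll mulKf.
rewrite b1 c1 pl_unstable pl_stable; split.
- split=> //.
  + move=> /eqP; rewrite scaler_eq0 mulf_eq0 (negPf g210) (negPf ga0) /=.
    by move=> /eqP z0; case: E2.
  + move=> /eqP; rewrite scaler_eq0 (negPf ga0) /= => /eqP z0; by case: E1.
  + by move=> s; rewrite !pl_unstable X_pl mulr0 l2E mulrA.
  + by move=> s; rewrite !pl_stable X_pl mulr0 mulrA.
  + move=> s; rewrite pl_unstable Y_pl; exists ((g12 * (s * be) + s1) / ga).
    by rewrite pl_stable divfK // !mulr0 mul0r !add0r.
  + rewrite b1 c1 Y_pl !mulr0 mul0r !add0r; congr pl.
    by rewrite /be /ga; field.
  + have w0E : w0 = pl 0 0 by rewrite /pl !scale0r !addr0.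
    (* the saddle point is the limit of the preimages of [a] under powers of [f^n] *)
    have lbL : (fun l => q l * be) @ \oo --> (0 : R).
      by rewrite -(mul0r be); apply: cvgM => //; exact: cvg_cst.
    have c0L : (fun=> 0 : R) @ \oo --> (0 : R) by exact: cvg_cst.
    rewrite w0E; apply: (follows_limit infinite_nat (ccvg_pl c0L lbL)).
    apply: filterS (nbhs_infty_gt 0) => l l0 _.
    have := back_follows l l0; rewrite -(prednK l0) word_powS -catA prednK //.
    by move=> /follows_cat[].
  + by have := back_follows 1%N isT; rewrite word_powS cats0 expr1 pl_unstable.
  + rewrite b1.
    apply: (follows_limit cycles (ccvg_pl quL bL)).
    apply: filterS near1 => k [_ Dk] Gk; rewrite -l2v.
    apply/follows_cat; rewrite -Xk_pl -pieces_cat fixS //; split; last exact: goodX.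
    by have /follows_cat[] := good_follows k Dk Gk.
  + rewrite c1; apply: (follows_limit cycles (ccvg_pl uL vL)).
    by apply: filterS near1 => k [_ Dk]; exact: goodX.
- have := abL 1%N; rewrite expr1 => ab1; apply: (lim_pl (aL 1%N) ab1).
  apply: filterS near1 => k [k1 Dk]; rewrite cycle_at ?leq_pred // -subn1.
  by have [-> ->] := back 1%N k k1.
- apply: (lim_pl quL bL); apply: filterS near1 => k [k1 Dk].
  by rewrite cycle_at // l2v.
- apply: (lim_pl uL vL); apply: filterS near1 => k [k1 Dk].
  by have := cycle_at 0%N k Dk isT; rewrite mul0n !expr0 !mul1r.
- have luL : (fun k => l1 * u k) @ \oo --> l1 * ga by apply: cvgM => //; exact: cvg_cst.
  have lvL : (fun k => l2 * v k) @ \oo --> (0 : R).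
    by rewrite -(mulr0 l2); apply: cvgM => //; exact: cvg_cst.
  apply: (lim_pl luL lvL); apply: filterS near1 => k [k1 Dk].
  by have := cycle_at 1%N k Dk k1; rewrite mul1n !expr1.
Qed.
End Limit.

(** * Segments, branches and the theorem *)

Section Final.
Context {R : realType} (p : bcnf R).
Implicit Types (z q : 'cV[R]_2).

Lemma segment_line (w0 : 'cV[R]_2) q (s t : R) z : s < t ->
  segment (w0 + s *: q) (w0 + t *: q) z <->
  exists2 u, s <= u <= t & z = w0 + u *: q.
Proof.
move=> st; split=> [[u u01 ->]|[u uI ->]].
  exists ((1 - u) * s + u * t).
    by move: u01 st; nra.
  by rewrite !scalerDr addrACA -scalerDl subrK scale1r !scalerA -scalerDl.
exists ((u - s) / (t - s)); first exact: comb_weight.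
exact: line_comb.
Qed.

Lemma segmentC (z1 z2 : 'cV[R]_2) : segment z1 z2 = segment z2 z1.
Proof.
suff sub y1 y2 : segment (R := R) y1 y2 `<=` segment y2 y1.
  by apply/seteqP; split; exact: sub.
by move=> _ [t t01 ->]; exists (1 - t); [lra|rewrite addrC subKr].
Qed.

Lemma PhiE X Y i : Phi p X Y i =
  iter i (bcmap p) @` segment (hom_a p X Y) (hom_b p X Y).
Proof.
elim: i => [|i IH]; first by rewrite image_id.
by rewrite /= IH -image_comp.
Qed.

(** As [f] is injective, images under negative iterates need not be taken: it is
    enough to compare forward orbits. *)
Lemma branchP X (zeta1 zeta2 q z : 'cV[R]_2) :
  (row_mx zeta1 zeta2 : 'M[R]_2) \in unitmx -> injective (bcmap p) ->
  branch p X zeta1 zeta2 q z <->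
  exists i j (t : R), 0 < t <= 1 /\
    iter i (bcmap p) z =
    iter j (bcmap p) (cycle_pt p X 0 + t *: (q - cycle_pt p X 0)).
Proof.
move=> Qu f_inj; set w0 := cycle_pt p X 0.
have localP y : local_branch p X zeta1 zeta2 q y <->
    exists2 t : R, 0 < t <= 1 & y = w0 + t *: (q - w0).
  split=> [[t tI]|[t tI ->]]; last first.
    by exists t => //; rewrite /uv -/w0 addrAC subrr add0r -scalemxAr.
  rewrite /uv -/w0 scalemxAr => /(can_inj (mulKVmx Qu)) E.
  by exists t => //; rewrite -E addrC subrK.
split=> [[i _]|[i [j [t [tI E]]]]].
  case: i => i /=.
    by move=> [y /localP[t tI ->] <-]; exists 0%N, i, t.
  by move=> /localP[t tI E]; exists i.+1, 0%N, t.
have inj k : injective (iter k (bcmap p)) by exact: iter_inj.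
have [ij|/ltnW ji] := leqP i j.
  exists (Posz (j - i)) => //; exists (w0 + t *: (q - w0)); first by apply/localP; exists t.
  by apply: (inj i); rewrite -iterD subnKC.
have E' : iter (i - j) (bcmap p) z = w0 + t *: (q - w0).
  by apply: (inj j); rewrite -iterD subnKC.
case: (i - j)%N E' => [/= ->|k E'].
  by exists 0 => //; exists (w0 + t *: (q - w0)) => //; apply/localP; exists t.
by exists (Negz k) => //; apply/localP; exists t.
Qed.

(** The interval from [lam] to [1] is a fundamental domain for the dilation by
    [lam^-1], which describes [f^n] on both branches. *)
Lemma power_window (lam t : R) : 0 < lam < 1 -> 0 < t <= 1 ->
  exists2 k, lam <= t / lam ^+ k & t / lam ^+ k <= 1.
Proof.
move=> /andP[l0 l1] /andP[t0 t1].
have lim0 : (fun k => lam ^+ k) @ \oo --> (0 : R) by apply: cvg_expr; rewrite gtr0_norm.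
have [K _ /(_ K (leqnn K)) ltK] := cvgr_lt _ lim0 t t0.
have exK : exists k, lam ^+ k < t by exists K.
case: (ex_minnP exK) => -[|k] kt kmin; first by rewrite expr0 ltNge t1 in kt.
have lk : 0 < lam ^+ k by rewrite exprn_gt0.
exists k; first by rewrite ler_pdivlMr // -exprS ltW.
by rewrite ler_pdivrMr // mul1r leNgt; apply/negP => /kmin; rewrite ltnn.
Qed.

End Final.

Theorem theorem4p1 (R : realType) (p : bcnf R) (X Y : word)
  (lambda1 lambda2 : R) (zeta1 zeta2 : 'cV[R]_2)
  (mu_neq0 : mu p <> 0)
  (X_prim : primitive X)
  (Y_nonempty : Y <> [::])
  (X0_neq_Y0 : symb X 0 <> symb Y 0)
  (cycles : infinite_set
     [set k : nat | (1 <= k)%N /\ has_good_cycle p (XkY X Y k)])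
  (eig1 : eigenvalue (word_mx p X) lambda1)
  (eig2 : eigenvalue (word_mx p X) lambda2)
  (lambda1_bounds : 0 <= lambda1 < 1)
  (lambda2_bound : 1 < lambda2)
  (zeta1_eig : eigenvector (word_mx p X) lambda1 zeta1)
  (zeta2_eig : eigenvector (word_mx p X) lambda2 zeta2)
  (v_axis : ~ parallel_to_switching zeta2)
  (f_inv : bijective (bcmap p))
  (Xi_two : exists z1 z2 : 'cV[R]_2,
     z1 <> z2 /\ Xi p X Y `&` switching_manifold = [set z1; z2]) :
  Phi p X Y (size X + size Y) = segment (hom_c p X Y) (hom_d p X Y) /\
  stable_branch p X Y zeta1 zeta2 = unstable_branch p X Y zeta1 zeta2.
Proof.
have f_inj : injective (bcmap p) := bij_inj f_inv.
have l12 : lambda1 < lambda2.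
  by have /andP[_ h] := lambda1_bounds; exact: lt_trans h lambda2_bound.
have [bv [cv [H aE bE cE dE]]] := homoclinic_limit X_prim Y_nonempty X0_neq_Y0
  cycles lambda1_bounds lambda2_bound zeta1_eig zeta2_eig v_axis f_inj.
set w0 := cycle_pt p X 0 in H aE bE cE dE.
have l0 := lam_gt0 H; have l1 := lam_lt1 H.
have abP z : segment (hom_a p X Y) (hom_b p X Y) z <->
    exists2 s, lambda1 <= s <= 1 & z = w0 + s *: bv.
  by rewrite aE bE -[w0 + bv]line1; exact: segment_line.
have cdP z : segment (hom_c p X Y) (hom_d p X Y) z <->
    exists2 s, lambda1 <= s <= 1 & z = w0 + s *: cv.
  by rewrite segmentC cE dE -[w0 + cv]line1; exact: segment_line.
have [z1 [z2 [_ XiE]]] := Xi_two.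
have two_points i s : (i < size X + size Y)%N -> lambda1 <= s <= 1 ->
    xcoord (iter i (bcmap p) (w0 + s *: bv)) = 0 ->
    iter i (bcmap p) (w0 + s *: bv) = z1 \/ iter i (bcmap p) (w0 + s *: bv) = z2.
  move=> iN sI x0.
  suff : (Xi p X Y `&` switching_manifold) (iter i (bcmap p) (w0 + s *: bv)).
    by rewrite XiE.
  split=> //; exists i => //; rewrite PhiE.
  by exists (w0 + s *: bv) => //; apply/abP; exists s.
have image := image_segment f_inj X_prim Y_nonempty H two_points.
have Phi_cd : Phi p X Y (size X + size Y) = segment (hom_c p X Y) (hom_d p X Y).
  rewrite PhiE; apply/seteqP; split=> z.
    by move=> [y /abP[s sI ->] <-]; apply/cdP; rewrite -image; exists s.
  by move=> /cdP; rewrite -image => -[s sI <-]; exists (w0 + s *: bv) => //; apply/abP; exists s.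
split=> //.
have Qu := eigen_unit zeta1_eig zeta2_eig l12.
have lI : 0 < lambda1 < 1 by rewrite l0.
have tE (t : R) k : t = lambda1 ^+ k * (t / lambda1 ^+ k).
  by rewrite mulrCA mulfV ?mulr1 // expf_neq0 // gt_eqF.
have bvE : hom_b p X Y - w0 = bv by rewrite bE addrAC subrr add0r.
have cvE : hom_c p X Y - w0 = cv by rewrite cE addrAC subrr add0r.
apply/seteqP; split=> z /(branchP _ _ _ Qu f_inj)[i [j [t [tI E]]]];
  apply/(branchP _ _ _ Qu f_inj); rewrite -/w0 bvE cvE in E *;
  have [k kl k1] := power_window lI tI.
  have tk01 : 0 <= t / lambda1 ^+ k <= 1 by rewrite k1 (le_trans (ltW l0)).
  have [s sI sE] : exists2 s, lambda1 <= s <= 1 &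
      iter (size X + size Y) (bcmap p) (w0 + s *: bv) = w0 + (t / lambda1 ^+ k) *: cv.
    by apply/image; exists (t / lambda1 ^+ k); rewrite ?kl.
  exists i, (j + (k * size X + (size X + size Y)))%N, s; split.
    by have /andP[ls ->] := sI; rewrite (lt_le_trans l0 ls).
  by rewrite E iterD (iterD (k * size X)) sE (iter_stable H) // -tE.
have tk01 : 0 <= t / lambda1 ^+ k <= 1 by rewrite k1 (le_trans (ltW l0)).
have [s sI sE] : exists2 s, lambda1 <= s <= 1 &
    iter (size X + size Y) (bcmap p) (w0 + (t / lambda1 ^+ k) *: bv) = w0 + s *: cv.
  by apply/image; exists (t / lambda1 ^+ k); rewrite ?kl.
exists (size X + size Y + k * size X + i)%N, j, s; split.
  by have /andP[ls ->] := sI; rewrite (lt_le_trans l0 ls).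
rewrite iterD E -iterD addnC iterD; congr (iter j _ _).
by rewrite iterD {1}(tE t k) (iter_unstable H) // sE.
Qed.
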